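(* For the path graph $I_n$ with $n$ edges, the normalized volume of the cosmological polytope $\mathcal{C}_{I_n}$ is $4^n$.
   Context: $I_n$ is the path graph with vertex set $[n+1]=\{1,\dots,n+1\}$ and edge set $\{ii+1: i\in[n]\}$. For an undirected graph $G=(V,E)$, let $x_i$ ($i\in V$) and $x_e$ ($e\in E$) denote the standard basis vectors of $\mathbb{R}^{|V|+|E|}$. The cosmological polytope of $G$ is $$\mathcal{C}_G=\mathrm{conv}\{x_i+x_j-x_e,\ x_i-x_j+x_e,\ -x_i+x_j+x_e ~:~ e=ij\in E\},$$ a lattice polytope of dimension $|V|+|E|-1$. The normalized volume is the volume on the affine span of $\mathcal{C}_G$ scaled so that a unimodular simplex with respect to the lattice $\mathbb{Z}^{|V|+|E|}\cap\mathrm{aff}(\mathcal{C}_G)$ has volume $1$. *)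

(* Defs.v *)
From HB Require Import structures.
From mathcomp Require Import all_boot all_order all_algebra.
From mathcomp Require Import all_classical all_reals all_analysis.

Set Implicit Arguments.
Unset Strict Implicit.
Unset Printing Implicit Defensive.

Import Order.TTheory GRing.Theory Num.Theory.

Local Open Scope classical_set_scope.
Local Open Scope ring_scope.

Section LebesgueTuple.
Variable R : realType.

Definition Rtuple (d : nat) := d.-tuple (measurableTypeR R).

Definition Rtuple_cons (d : nat) (q : Rtuple d * measurableTypeR R) :
  Rtuple d.+1 := [tuple of q.2 :: q.1].

Lemma measurable_Rtuple_cons (d : nat) :
  measurable_fun [set: Rtuple d * measurableTypeR R] (@Rtuple_cons d).
Proof. exact: measurable_cons. Qed.

(* Lebesgue measure on R^d: the point mass for d = 0, and for d > 0 the product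
   of the measures on R^(d-1) and R, carried to d-tuples by (t, x) |-> x :: t.
   The long name is the library's measure structure on a pushforward, which
   cannot be inferred because it depends on the measurability proof. *)
Fixpoint lebesgue_tuple (d : nat) : {measure set Rtuple d -> \bar R} :=
  match d with
  | 0 => dirac ([tuple] : Rtuple 0)
  | d'.+1 =>
      measure_function_pushforward__canonical__measure_function_Measure
        (lebesgue_tuple d' \x @lebesgue_measure R)%E
        (@measurable_Rtuple_cons d')
  end.

End LebesgueTuple.

Section NormalizedVolume.
Variables (R : realType) (V : lmodType R).

Definition conv_hull (S : set V) : set V :=
  [set x | exists (m : nat) (a : 'I_m -> R) (v : 'I_m -> V),
     [/\ forall k, 0 <= a k, \sum_k a k = 1, forall k, S (v k)
       & x = \sum_k a k *: v k]].

Definition aff_hull (S : set V) : set V :=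
  [set x | exists (m : nat) (a : 'I_m -> R) (v : 'I_m -> V),
     [/\ \sum_k a k = 1, forall k, S (v k) & x = \sum_k a k *: v k]].

Definition frame_map (d : nat) (p : V) (b : 'I_d -> V) (t : Rtuple R d) : V :=
  p + \sum_i (tnth t i : R) *: b i.

(* (p, b) is an affine basis of the lattice L `&` aff_hull P: it gives affine
   coordinates on aff_hull P in which the points of L are those of Z^d.
   Equivalently, the p and p + b i are the vertices of a unimodular simplex. *)
Definition lattice_frame (L P : set V) (d : nat) (p : V) (b : 'I_d -> V) :=
  [/\ injective (frame_map p b),
      aff_hull P = range (frame_map p b)
    & L `&` aff_hull P =
      frame_map p b @` [set t | forall i, (tnth t i : R) \is a Num.int]].

Definition frame_simplex (d : nat) (p : V) (b : 'I_d -> V) : set V :=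
  conv_hull (p |` range (fun i => p + b i)).

(* The volume of P on aff_hull P, rescaled by the constant c for which a
   unimodular simplex has volume 1. For a Borel set P the product does not
   depend on the frame, so the set below has at most one element; the value
   is 0 by default if there is no frame. *)
Definition normalized_volume (L P : set V) : \bar R :=
  xget 0%E [set v | exists (d : nat) (p : V) (b : 'I_d -> V) (c : R),
    let vol (A : set V) := lebesgue_tuple R d (frame_map p b @^-1` A) in
    [/\ lattice_frame L P p b,
        (c%:E * vol (frame_simplex p b))%E = 1%E
      & v = (c%:E * vol P)%E]].

End NormalizedVolume.

Record sgraph := Sgraph {
  vertex :> finType;
  edges : {set {set vertex}};
  edges_card2 : forall e : {set vertex}, e \in edges -> #|e| = 2%N
}.

Definition edge (G : sgraph) := {e : {set G} | e \in edges G}.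

Section CosmologicalPolytope.
Variables (R : realType) (G : sgraph).

(* R^(|V| + |E|), with coordinates indexed by the disjoint union of the vertices
   and the edges. *)
Definition cspace := {ffun (G + edge G)%type -> R^o}.

Definition xvec (k : G + edge G) : cspace := [ffun l => (l == k)%:R].

Definition cosmological_polytope : set cspace :=
  conv_hull [set z | exists (i j : G) (e : edge G),
    [/\ i != j, val e = [set i; j]%SET
      & [\/ z = xvec (inl i) + xvec (inl j) - xvec (inr e),
            z = xvec (inl i) - xvec (inl j) + xvec (inr e)
          | z = - xvec (inl i) + xvec (inl j) + xvec (inr e)]]].

Definition integer_lattice : set cspace :=
  [set z | forall k, (z k : R) \is a Num.int].

End CosmologicalPolytope.

(* Vertices 0, ..., n instead of 1, ..., n + 1. *)
Definition path_edges (n : nat) : {set {set 'I_n.+1}} :=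
  [set [set widen_ord (leqnSn n) i; lift ord0 i]%SET | i : 'I_n]%SET.

Lemma path_edges_card2 (n : nat) (e : {set 'I_n.+1}) :
  e \in path_edges n -> #|e| = 2%N.
Proof.
case/imsetP => i _ ->; rewrite cards2.
by rewrite -val_eqE /= /bump /= add1n neq_ltn ltnSn.
Qed.

Definition path_graph (n : nat) : sgraph := Sgraph (@path_edges_card2 n).

(* Main.v *)
Require Import Defs.
From HB Require Import structures.
From mathcomp Require Import all_boot all_order all_algebra.
From mathcomp Require Import all_classical all_reals all_analysis.
From mathcomp Require Import measurable_realfun.
From mathcomp Require Import zify ring lra.

Set Implicit Arguments.
Unset Strict Implicit.
Unset Printing Implicit Defensive.

Import Order.TTheory GRing.Theory Num.Theory.

Local Open Scope classical_set_scope.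
Local Open Scope ring_scope.

(** The polytope lies in the hyperplane where the coordinates sum to 1, and the
cone over it has a recursive description.  Write [x_0, ..., x_n] for the vertex
coordinates and [y_0, ..., y_(n-1)] for the edge coordinates, edge [k] joining
[k] and [k+1].  A point is in the cone iff it splits into contributions of the
edges, each in the cone over a triangle.  The cone contains the basis vectors,
hence is upward closed in each coordinate, so it is optimal for edge [k] to
return to vertex [k+1] as much as it can.  This greedy choice is the potential
[w_0 = x_0], [w_(k+1) = x_(k+1) + min (w_k, y_k)], and the cone is given by
[w_k + y_k >= 0] for all [k < n] and [w_n >= 0] ([path_polytopeE]).

For fixed [y], the change of variables from [x] to [w] is a shear, so it
preserves the volume, and the coordinate sum becomes
[w_n + \sum_k max (w_k, y_k)].  In the coordinates other than [x_n] the polytope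
is therefore, up to the shear, the set of pairs [(w_k, y_k)], [k < n], with
[w_k + y_k >= 0] and [\sum_k max (w_k, y_k) <= 1].  In the plane, the triangle
[w + y >= 0, max (w, y) <= r] has 4 times the area of [w, y >= 0, w + y <= r];
replacing the pairs one at a time ([integral_path_region]) yields 4 ^ n times
the volume of the corner simplex [t_i >= 0, \sum_i t_i <= 1].

The frame used to measure the volume is arbitrary.  A frame pulls its own
simplex back to the corner simplex ([preimage_frame_simplex]), and two frames
differ by an affine bijection of R^d that preserves Z^d.  Such a map preserves
the Lebesgue measure ([tuple_measure_lattice_map]): this needs no determinants,
only Tonelli's theorem, translation invariance, and the fact that all
fundamental domains of Z^d have the same measure.  Hence the ratio of the two
volumes is the same in all frames. *)

(** * Lebesgue measure on tuples *)

Section LineTranslation.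
Variable R : realType.
Local Notation leb := (@lebesgue_measure R).

Lemma lebesgue_measure_translation (a : R) (A : set R) : measurable A ->
  leb ((fun x => x + a) @^-1` A) = leb A.
Proof.
move=> mA.
have ma : measurable_fun [set: measurableTypeR R]
    ((fun x => x + a) : measurableTypeR R -> measurableTypeR R).
  exact: measurable_funD.
pose nu := measure_function_pushforward__canonical__measure_function_Measure leb ma.
suff: leb A = nu A by move=> ->.
apply: lebesgue_measure_unique => //.
move=> _ [[x y] _ <-] /=.
rewrite /pushforward (_ : _ @^-1` _ = `]x - a, y - a]%classic); last first.
  by apply/seteqP; split => z /=; rewrite !in_itv/= ltrBlDr lerBrDr.
rewrite !lebesgue_measure_itv /= !lte_fin ltrD2r; case: ifP => // _.
by rewrite -!EFinB opprB addrA subrK.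
Qed.

Lemma integral_translation (a : R) (f : R -> \bar R) :
  measurable_fun [set: R] f -> (forall x, 0 <= f x)%E ->
  (\int[leb]_x f (x + a)%R = \int[leb]_x f x)%E.
Proof.
move=> mf f0.
have ma : measurable_fun [set: measurableTypeR R]
    ((fun x => x + a) : measurableTypeR R -> measurableTypeR R).
  exact: measurable_funD.
transitivity (\int[pushforward leb ((fun x => (x + a)%R) : measurableTypeR R -> measurableTypeR R)]_x f x)%E.
  by rewrite ge0_integral_pushforward.
apply: eq_measure_integral => A mA _.
exact: lebesgue_measure_translation.
Qed.

End LineTranslation.

Section TupleMeasure.
Variable R : realType.
Local Notation leb := (@lebesgue_measure R).
Local Notation Rt := (Rtuple R).

(** A head constant for [lebesgue_tuple], to which the sigma-finiteness instance
required by Tonelli's theorem can be attached. *)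
Definition tuple_measure (d : nat) : set (Rt d) -> \bar R := lebesgue_tuple R d.

HB.instance Definition _ d := Measure.on (@tuple_measure d).

Lemma tuple_measureS d (A : set (Rt d.+1)) :
  tuple_measure A =
  (@tuple_measure d \x leb)%E (@Rtuple_cons R d @^-1` A).
Proof. by []. Qed.

Definition tuple_head d (t : Rt d.+1) : R := thead t.
Definition tuple_tail d (t : Rt d.+1) : Rt d := [tuple of behead t].

Definition cube (d : nat) (I : set R) : set (Rt d) :=
  [set t | forall i, I (tnth t i)].

Lemma cubeS d (I : set R) (t : Rt d) (x : R) :
  cube I (Rtuple_cons (t, x)) <-> cube I t /\ I x.
Proof.
split=> [It|[It Ix] i].
  split=> [i|]; last by have := It ord0; rewrite tnth0.
  by have := It (lift ord0 i); rewrite tnthS.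
by case: (unliftP ord0 i) => [j|] ->; rewrite ?tnthS ?tnth0.
Qed.

Lemma measurable_cube d (I : set R) : measurable I -> measurable (@cube d I).
Proof.
move=> mI; rewrite (_ : cube I = \bigcap_(i in [set: 'I_d]) ((@tnth _ _)^~ i @^-1` I)).
  apply: fin_bigcap_measurable => [|i _]; first exact: finite_finset.
  rewrite -[X in measurable X]setTI.
  exact: measurable_tnth.
by apply/seteqP; split => t /= It i; [move=> _; exact: It|exact: (It i Logic.I)].
Qed.

Lemma tuple_measure_cube d (I : set R) : measurable I ->
  tuple_measure (@cube d I) = (\prod_(i < d) leb I)%E.
Proof.
move=> mI; elim: d => [|d IH].
  rewrite big_ord0 /tuple_measure /= diracE mem_set//; by case.
rewrite tuple_measureS (_ : _ @^-1` _ = @cube d I `*` I); last first.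
  by apply/seteqP; split => -[t x] /cubeS.
rewrite product_measure1E//; last exact: measurable_cube.
by rewrite big_ord_recr /= IH.
Qed.

Let tuple_measure_sigma_finite d : sigma_finite setT (@tuple_measure d).
Proof.
exists (fun n => @cube d `[- n%:R, n%:R]%classic).
  apply/seteqP; split => // t _.
  pose M := \sum_(i < d) `|tnth t i : R|.
  exists (Num.truncn M).+1 => // i /=; rewrite in_itv /= -ler_norml.
  rewrite (le_trans _ (ltW (truncnS_gt M)))//.
  by rewrite /M (bigD1 i)//= lerDl sumr_ge0.
move=> n; split; first exact: measurable_cube.
rewrite tuple_measure_cube// lebesgue_measure_itv /=.
rewrite ltey_eq; apply/orP; left.
elim/big_ind : _ => // [x y xfin yfin|i _]; first by rewrite fin_numM.
by case: ifP.
Qed.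

HB.instance Definition _ d :=
  Measure_isSigmaFinite.Build _ _ _ (@tuple_measure d) (@tuple_measure_sigma_finite d).

Lemma integral_tuple_cons d (f : Rt d.+1 -> \bar R) :
  measurable_fun setT f -> (forall t, 0 <= f t)%E ->
  (\int[@tuple_measure d.+1]_t f t =
   \int[@tuple_measure d]_t \int[leb]_x f (Rtuple_cons (t, x)))%E.
Proof.
move=> mf f0.
rewrite [LHS](_ : _ =
   (\int[pushforward (@tuple_measure d \x leb) (@Rtuple_cons R d)]_t f t)%E) //.
rewrite ge0_integral_pushforward//; last exact: measurable_Rtuple_cons.
rewrite preimage_setT fubini_tonelli1 //.
- by apply: measurableT_comp => //; exact: measurable_Rtuple_cons.
- by move=> x; exact: f0.
Qed.

Lemma measurable_integral_cons d (f : Rt d.+1 -> \bar R) :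
  measurable_fun setT f -> (forall t, 0 <= f t)%E ->
  measurable_fun setT (fun t : Rt d => \int[leb]_x f (Rtuple_cons (t, x)))%E.
Proof.
move=> mf f0.
apply: (measurable_fun_fubini_tonelli_F (m2 := leb) (f \o @Rtuple_cons R d)) => //.
- by apply: measurableT_comp => //; exact: measurable_Rtuple_cons.
- by move=> x; exact: f0.
Qed.

Lemma measurable_cons_section d (f : Rt d.+1 -> \bar R) (t : Rt d) :
  measurable_fun setT f ->
  measurable_fun setT (fun x : measurableTypeR R => f (Rtuple_cons (t, x))).
Proof.
move=> mf; apply: measurableT_comp => //.
by apply: measurableT_comp; [exact: measurable_Rtuple_cons|exact: measurable_fun_pair].
Qed.

Definition tuple_add d (t s : Rt d) : Rt d :=
  [tuple (tnth t i : R) + (tnth s i : R) | i < d].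

Lemma tnth_tuple_add d (t s : Rt d) i :
  tnth (tuple_add t s) i = (tnth t i : R) + (tnth s i : R).
Proof. by rewrite tnth_mktuple. Qed.

Lemma tuple_add_cons d (t s : Rt d) (x y : R) :
  tuple_add (Rtuple_cons (t, x)) (Rtuple_cons (s, y)) =
  Rtuple_cons (tuple_add t s, x + y).
Proof.
apply: eq_from_tnth => i; rewrite tnth_tuple_add.
by case: (unliftP ord0 i) => [j|] ->; rewrite ?tnthS ?tnth0// tnth_tuple_add.
Qed.

Lemma tuple_consE d (t : Rt d.+1) : t = Rtuple_cons (tuple_tail t, tuple_head t).
Proof. by rewrite [LHS]tuple_eta. Qed.

Lemma measurable_tuple_add d :
  measurable_fun [set: Rt d * Rt d] (fun p => tuple_add p.1 p.2).
Proof.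
apply/measurable_fun_tnthP => i.
rewrite (_ : _ \o _ =
  (fun p : Rt d * Rt d => (tnth p.1 i : R) + (tnth p.2 i : R))); last first.
  by apply/funext => p /=; rewrite tnth_tuple_add.
apply: measurable_funD.
  by apply: (measurableT_comp (f := fun t : Rt d => tnth t i)) => //; exact: measurable_tnth.
by apply: (measurableT_comp (f := fun t : Rt d => tnth t i)) => //; exact: measurable_tnth.
Qed.

Lemma measurable_tuple_addr d (s : Rt d) :
  measurable_fun [set: Rt d] (fun t : Rt d => tuple_add t s).
Proof.
apply: (measurableT_comp (@measurable_tuple_add d) (g := fun t => (t, s))).
exact: measurable_fun_pair.
Qed.

(** Tonelli's theorem splits off the head of the tuple, where this is translation
invariance on the line. *)
Lemma integral_tuple_translation d (s : Rt d) (f : Rt d -> \bar R) :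
  measurable_fun setT f -> (forall t, 0 <= f t)%E ->
  (\int[@tuple_measure d]_t f (tuple_add t s) = \int[@tuple_measure d]_t f t)%E.
Proof.
elim: d s f => [|d IH] s f mf f0.
  by apply: eq_integral => t _; congr f; apply: eq_from_tnth; case.
rewrite (@integral_tuple_cons _ (fun t => f (tuple_add t s)))//; last first.
  exact: (measurableT_comp mf (measurable_tuple_addr s)).
rewrite [RHS]integral_tuple_cons//.
rewrite -[RHS](IH (tuple_tail s)); last 2 first.
- exact: measurable_integral_cons.
- by move=> t; exact: integral_ge0.
apply: eq_integral => t _; rewrite [s in LHS]tuple_consE.
under eq_integral do rewrite tuple_add_cons.
rewrite (integral_translation (tuple_head s)
  (f := fun x => f (Rtuple_cons (tuple_add t (tuple_tail s), x))))//.
exact: measurable_cons_section.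
Qed.

Lemma tuple_measure_translation d (s : Rt d) (A : set (Rt d)) : measurable A ->
  tuple_measure ((fun t : Rt d => tuple_add t s) @^-1` A) = tuple_measure A.
Proof.
move=> mA.
have measE (B : set (Rt d)) : measurable B ->
    tuple_measure B = (\int[@tuple_measure d]_t (\1_B t)%:E)%E.
  by move=> mB; rewrite integral_indic// setIT.
rewrite !measE//; last first.
  by rewrite -[X in measurable X]setTI; exact: measurable_tuple_addr.
rewrite -[RHS](integral_tuple_translation s)//.
by apply/measurable_EFinP; exact: measurable_indic.
Qed.

End TupleMeasure.

(** * Affine bijections that preserve the integer lattice *)

Section Lattice.
Variables (R : realType) (d : nat).
Local Notation Rt := (Rtuple R d).
Local Notation mu := (@tuple_measure R d).

Definition int_tuple (k : {ffun 'I_d -> int}) : Rt := [tuple ((k i)%:~R : R) | i < d].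

Definition tuple_sub (t s : Rt) : Rt :=
  [tuple (tnth t i : R) - (tnth s i : R) | i < d].

Lemma tnth_tuple_sub (t s : Rt) i :
  tnth (tuple_sub t s) i = (tnth t i : R) - (tnth s i : R).
Proof. by rewrite tnth_mktuple. Qed.

Lemma tuple_addK (t s : Rt) : tuple_sub (tuple_add t s) s = t.
Proof.
by apply: eq_from_tnth => i; rewrite tnth_tuple_sub tnth_tuple_add addrK.
Qed.

Lemma measurable_tuple_sub :
  measurable_fun [set: Rt * Rt] (fun p => tuple_sub p.1 p.2).
Proof.
apply/measurable_fun_tnthP => i.
rewrite (_ : _ \o _ =
  (fun p : Rt * Rt => (tnth p.1 i : R) - (tnth p.2 i : R))); last first.
  by apply/funext => p /=; rewrite tnth_tuple_sub.
apply: measurable_funB.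
  by apply: (measurableT_comp (f := fun t : Rt => tnth t i)) => //; exact: measurable_tnth.
by apply: (measurableT_comp (f := fun t : Rt => tnth t i)) => //; exact: measurable_tnth.
Qed.

Definition fundamental_domain (D : set Rt) :=
  measurable D /\ forall t, exists! k, D (tuple_add t (int_tuple k)).

Lemma int_tuple_addN (t : Rt) k :
  tuple_add (tuple_add t (int_tuple k)) (int_tuple (- k)) = t.
Proof.
apply: eq_from_tnth => i; rewrite !tnth_tuple_add !tnth_mktuple ffunE.
by rewrite mulrNz addrK.
Qed.

(** [D] is cut along the translates of [E].  The pieces are indexed by [nat]
through [pickle_inv], as required by countable additivity; the bijection [f]
relabels them, so that the cuts of [D] by [E] and of [E] by [D] can be matched
piece by piece. *)
Lemma fundamental_domain_decomp (D E : set Rt) (f : {ffun 'I_d -> int} -> {ffun 'I_d -> int}) :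
  measurable D -> fundamental_domain E -> bijective f ->
  mu D = (\sum_(j <oo) mu (if pickle_inv j is Some k then
     D `&` [set t | E (tuple_add t (int_tuple (f k)))] else set0))%E.
Proof.
move=> mD [mE Eu] [g fK gK].
rewrite -measure_semi_bigcup.
- congr (mu _); apply/seteqP; split => [t Dt|t [j _]]; last first.
    by case: (pickle_inv j) => // k [].
  have [k [Ek _]] := Eu t; exists (pickle (g k)) => //.
  by rewrite pickleK_inv gK.
- move=> j; case: (pickle_inv j) => // k; apply: measurableI => //.
  by rewrite -[X in measurable X]setTI; exact: measurable_tuple_addr.
- move=> i j _ _ [t].
  case ik: (pickle_inv i) => [k|] [] //=; case jl: (pickle_inv j) => [l|] //=.
  move=> [_ Ek] [_ El]; have [m [_ um]] := Eu t.
  have kl : k = l by apply: (can_inj fK); rewrite -(um _ Ek) -(um _ El).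
  have := @pickle_invK {ffun 'I_d -> int} i; rewrite ik /= => <-.
  by have := @pickle_invK {ffun 'I_d -> int} j; rewrite jl /= => <-; rewrite kl.
- apply: bigcup_measurable => j _; case: (pickle_inv j) => // k.
  apply: measurableI => //.
  by rewrite -[X in measurable X]setTI; exact: measurable_tuple_addr.
Qed.

(** Translating the piece of [D] in [E - k] by [k] gives the piece of [E] in
[D + k]. *)
Lemma fundamental_domain_measure (D E : set Rt) :
  fundamental_domain D -> fundamental_domain E -> mu D = mu E.
Proof.
move=> fD fE; have [mD _] := fD; have [mE _] := fE.
rewrite (fundamental_domain_decomp (f := id) mD fE); last by exists id.
rewrite (fundamental_domain_decomp (f := -%R) mE fD); last by exists -%R => ?; rewrite opprK.
apply: eq_eseriesr => j _; case: (pickle_inv j) => // k.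
rewrite -[RHS](tuple_measure_translation (int_tuple k)); last first.
  apply: measurableI => //.
  by rewrite -[X in measurable X]setTI; exact: measurable_tuple_addr.
congr (mu _); apply/seteqP; split => t /=; rewrite int_tuple_addN; tauto.
Qed.

Definition unit_cube : set Rt := cube `[0, 1[%classic.

Lemma unit_cube_floor (t : Rt) k :
  unit_cube (tuple_sub t (int_tuple k)) <-> k = [ffun i => Num.floor (tnth t i : R)].
Proof.
split=> [tk|-> i /=].
  apply/ffunP => i; rewrite ffunE; apply/esym/floor_def.
  have := tk i; rewrite /= in_itv/= tnth_tuple_sub tnth_mktuple subr_ge0.
  by rewrite ltrBlDl intrD.
rewrite in_itv/= tnth_tuple_sub tnth_mktuple ffunE subr_ge0 ltrBlDl.
by have /andP[-> /=] := floor_itv (tnth t i : R); rewrite intrD.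
Qed.

Lemma measurable_unit_cube : measurable unit_cube.
Proof. exact: measurable_cube. Qed.

Lemma unit_cube_fundamental : fundamental_domain unit_cube.
Proof.
split=> [|t]; first exact: measurable_unit_cube.
have addE k : tuple_add t (int_tuple k) = tuple_sub t (int_tuple (- k)).
  apply: eq_from_tnth => i; rewrite tnth_tuple_sub tnth_tuple_add !tnth_mktuple.
  by rewrite ffunE mulrNz opprK.
exists (- [ffun i => Num.floor (tnth t i : R)]); split=> [|k].
  by rewrite addE opprK; exact/unit_cube_floor.
by rewrite addE => /unit_cube_floor <-; rewrite opprK.
Qed.

Lemma tuple_measure_unit_cube : mu unit_cube = 1%E.
Proof.
rewrite tuple_measure_cube// big1// => i _.
by rewrite lebesgue_measure_itv /= lte01 oppr0 adde0.
Qed.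

(** Let [E] be the unit cube.  The product of the measures of [g^-1(A)] and [E]
is the double integral of the indicator of [A (g x + y) /\ E y], because for each
[y] the set of the [x] with [A (g x + y)] is a translate of [g^-1(A)].  After the
substitution of [y - g x] for [y] the integrand is the indicator of
[A y /\ E (y - g x)], and for each [y] the set of the [x] with [E (y - g x)] is a
fundamental domain, of measure 1.  So the double integral is also the measure of
[A]. *)
Lemma tuple_measure_lattice_map (g : Rt -> Rt)
    (f : {ffun 'I_d -> int} -> {ffun 'I_d -> int}) :
  measurable_fun setT g -> bijective f ->
  (forall s, exists u, forall t, tuple_add (g t) s = g (tuple_add t u)) ->
  (forall t k, g (tuple_add t (int_tuple k)) = tuple_add (g t) (int_tuple (f k))) ->
  forall A, measurable A -> mu (g @^-1` A) = mu A.
Proof.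
move=> mg [h fK hK] gtr gint A mA.
pose E := unit_cube; have mE : measurable E := measurable_unit_cube.
pose W := [set p : Rt * Rt | A (tuple_add (g p.1) p.2) /\ E p.2].
pose W' := [set p : Rt * Rt | A p.2 /\ E (tuple_sub p.2 (g p.1))].
have mgA : measurable (g @^-1` A) by rewrite -[X in measurable X]setTI; exact: mg.
have mg1 : measurable_fun [set: Rt * Rt] (fun p => g p.1).
  exact: measurableT_comp.
have mW : measurable W.
  apply: measurableI; last by rewrite -[X in measurable X]setTI; exact: measurable_snd.
  rewrite -[X in measurable X]setTI.
  apply: (measurableT_comp (@measurable_tuple_add R d)
    (g := fun p : Rt * Rt => (g p.1, p.2))) => //.
  exact: measurable_fun_pair.
have mW' : measurable W'.
  apply: measurableI; first by rewrite -[X in measurable X]setTI; exact: measurable_snd.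
  rewrite -[X in measurable X]setTI.
  apply: (measurableT_comp measurable_tuple_sub
    (g := fun p : Rt * Rt => (p.2, g p.1))) => //.
  exact: measurable_fun_pair.
have measE (B : set Rt) : measurable B -> (\int[mu]_t (\1_B t)%:E = mu B)%E.
  by move=> mB; rewrite integral_indic// setIT.
have fub (V : set (Rt * Rt)) : measurable V ->
    (\int[mu]_x \int[mu]_y (\1_V (x, y))%:E = \int[mu]_y \int[mu]_x (\1_V (x, y))%:E)%E.
  move=> mV; apply: (fubini_tonelli (fun p => (\1_V p)%:E)).
    by apply/measurable_EFinP; exact: measurable_indic.
  by move=> p; rewrite lee_fin.
transitivity (\int[mu]_x \int[mu]_y (\1_W (x, y))%:E)%E.
  rewrite fub// -[LHS]mule1 -tuple_measure_unit_cube -/E -(measE E)//.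
  rewrite -ge0_integralZl//; last by apply/measurable_EFinP; exact: measurable_indic.
  apply: eq_integral => y _.
  have [u gu] := gtr y.
  rewrite -(tuple_measure_translation u)// -measE; last first.
    by rewrite -[X in measurable X]setTI; exact: measurable_tuple_addr.
  rewrite -ge0_integralZr//; last first.
    apply/measurable_EFinP; apply: measurable_indic.
    by rewrite -[X in measurable X]setTI; exact: measurable_tuple_addr.
  apply: eq_integral => x _; rewrite -EFinM; congr EFin.
  rewrite !indicE -natrM mulnb; congr ((_ : bool)%:R).
  apply/andP/idP => [[/set_mem /= Agx /set_mem Ey]|/set_mem[/= Agx Ey]].
    by apply/mem_set; split => //=; rewrite gu.
  by split; apply/mem_set => //=; rewrite -gu.
transitivity (\int[mu]_x \int[mu]_y (\1_W' (x, y))%:E)%E.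
  apply: eq_integral => x _.
  rewrite -[RHS](integral_tuple_translation (g x)).
  - apply: eq_integral => y _; congr (_%:E); rewrite !indicE; congr ((_ : bool)%:R).
    have WE : W (x, y) = W' (x, tuple_add y (g x)).
      rewrite /W /W' /= tuple_addK; congr (A _ /\ _).
      by apply: eq_from_tnth => i; rewrite !tnth_tuple_add addrC.
    by apply/idP/idP => /set_mem wxy; apply/mem_set; move: wxy; rewrite WE.
  - apply/measurable_EFinP; apply: measurableT_comp; first exact: measurable_indic.
    exact: measurable_fun_pair.
  - by move=> t; rewrite lee_fin.
rewrite fub// -[RHS]measE//.
apply: eq_integral => y _.
(* [x + k] is in [Dy] iff [f k] is the integer part of [y - g x], which holds for
   exactly one [k] as [f] is bijective. *)
pose Dy := [set x | E (tuple_sub y (g x))].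
have mDy : measurable Dy.
  rewrite -[X in measurable X]setTI.
  apply: (measurableT_comp measurable_tuple_sub (g := fun x : Rt => (y, g x))) => //.
  exact: measurable_fun_pair.
have fDy : fundamental_domain Dy.
  split => // x.
  have subE k : tuple_sub y (g (tuple_add x (int_tuple k))) =
      tuple_sub (tuple_sub y (g x)) (int_tuple (f k)).
    rewrite gint; apply: eq_from_tnth => i.
    by rewrite !tnth_tuple_sub tnth_tuple_add opprD addrA.
  exists (h [ffun i => Num.floor (tnth (tuple_sub y (g x)) i : R)]); split => [|k].
    by rewrite /Dy /= subE; apply/unit_cube_floor; rewrite hK.
  by rewrite /Dy /= subE => /unit_cube_floor <-; rewrite fK.
rewrite -[RHS]mule1 -tuple_measure_unit_cube.
rewrite -(fundamental_domain_measure fDy unit_cube_fundamental) -measE//.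
rewrite -ge0_integralZl//; last by apply/measurable_EFinP; exact: measurable_indic.
apply: eq_integral => x _; rewrite -EFinM; congr EFin.
rewrite !indicE -natrM mulnb; congr ((_ : bool)%:R).
by apply/idP/andP => [/set_mem[Ay Ex]|[/set_mem Ay /set_mem Ex]]; [split|]; apply/mem_set.
Qed.

End Lattice.

(** * Integrals over a half plane and a quadrant *)

Section PlaneIdentity.
Variable R : realType.
Local Notation leb := (@lebesgue_measure R).
Implicit Types (phi : R -> \bar R) (x y : R).

Lemma integral_if_const (P : pred R) (c : \bar R) :
  measurable [set x | P x] -> (0 <= c)%E ->
  (\int[leb]_x (if P x then c else 0) = c * leb [set x | P x])%E.
Proof.
move=> mP c0.
under eq_integral => x _.
  rewrite (_ : (if _ then _ else _) = c * (\1_[set x | P x] x)%:E)%E; last first.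
    rewrite indicE; case: ifPn => Px; first by rewrite mem_set// mule1.
    by rewrite memNset ?mule0//; exact/negP.
  over.
rewrite ge0_integralZl//; last by apply/measurable_EFinP; exact: measurable_indic.
by rewrite integral_indic// setIT.
Qed.

Lemma lebesgue_fubini (f : R -> R -> \bar R) :
  measurable_fun [set: R * R] (fun p => f p.1 p.2) ->
  (forall x y, 0 <= f x y)%E ->
  (\int[leb]_x \int[leb]_y f x y = \int[leb]_y \int[leb]_x f x y)%E.
Proof.
move=> mf f0.
apply: (@fubini_tonelli _ _ _ _ _ leb leb
  (fun p : measurableTypeR R * measurableTypeR R => f p.1 p.2)) => //.
Qed.

Lemma measurable_lebesgue_integral (f : R -> R -> \bar R) :
  measurable_fun [set: R * R] (fun p => f p.1 p.2) ->
  (forall x y, 0 <= f x y)%E ->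
  measurable_fun [set: R] (fun x => \int[leb]_y f x y)%E.
Proof.
move=> mf f0.
apply: (@measurable_fun_fubini_tonelli_F _ _ _ _ _ leb
  (fun p : measurableTypeR R * measurableTypeR R => f p.1 p.2)) => //.
Qed.

Lemma measurable_fun_if_comp d (T : measurableType d) (P : T -> bool) (f : T -> R) phi :
  measurable_fun setT phi -> measurable_fun setT P -> measurable_fun setT f ->
  measurable_fun setT (fun p => if P p then phi (f p) else 0%E).
Proof. by move=> mphi mP mf; apply: measurable_fun_ifT => //; exact: measurableT_comp. Qed.

Lemma measurable_mul_max phi : measurable_fun setT phi ->
  measurable_fun [set: R] (fun x => phi x * (Num.max 0 x)%:E)%E.
Proof.
move=> mphi; apply: emeasurable_funM => //.
by apply/measurable_EFinP; apply: measurable_maxr => //; exact: measurable_cst.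
Qed.

(** The weight is the length of the segment [x + y = z] of the quadrant, measured
in [x]. *)
Lemma integral_quadrant_add phi : measurable_fun setT phi ->
  (forall x, 0 <= phi x)%E ->
  (\int[leb]_x \int[leb]_y
     (if ((0 <= x) && (0 <= y))%R then phi (x + y)%R else 0) =
   \int[leb]_x (phi x * (Num.max 0 x)%R%:E))%E.
Proof.
move=> mphi phi0.
have m1 : measurable_fun [set: R * R] (fun p => p.1) by exact: measurable_fst.
have m2 : measurable_fun [set: R * R] (fun p => p.2) by exact: measurable_snd.
have if0 (b : bool) z : (0 <= if b then phi z else 0)%E by case: ifP.
transitivity (\int[leb]_x \int[leb]_y
    (if ((0 <= x) && (x <= y))%R then phi y else 0))%E.
  apply: eq_integral => x _.
  rewrite -[RHS](integral_translation x)//; last first.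
    apply: measurable_fun_ifT => //.
    apply: measurable_and => //; exact: measurable_fun_ler.
  by apply: eq_integral => y _; rewrite lerDr addrC.
transitivity (\int[leb]_y \int[leb]_x
    (if ((0 <= x) && (x <= y))%R then phi y else 0))%E.
  apply: (lebesgue_fubini (f := fun x y =>
    if ((0 <= x) && (x <= y))%R then phi y else 0%E)) => //.
  apply: measurable_fun_if_comp => //.
  by apply: measurable_and; exact: measurable_fun_ler.
apply: eq_integral => y _ /=.
have E : [set x | (0 <= x <= y)%R] = `[0, y]%classic.
  by apply/seteqP; split => x; rewrite /= in_itv.
rewrite integral_if_const ?E//; congr (_ * _)%E.
rewrite lebesgue_measure_itv /= lte_fin maxEle.
by case: ltgtP => //= x0; rewrite -?x0// oppr0 adde0.
Qed.

(** The level set [max (x, y) = z] of the half plane is made of two segments of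
length [2 z], one in each of the parts [y <= x] and [x < y]. *)
Lemma integral_halfplane_max phi : measurable_fun setT phi ->
  (forall x, 0 <= phi x)%E ->
  (\int[leb]_x \int[leb]_y (if (0 <= x + y)%R then phi (Num.max x y) else 0) =
   4%:R%:E * \int[leb]_x (phi x * (Num.max 0 x)%R%:E))%E.
Proof.
move=> mphi phi0.
have m1 : measurable_fun [set: R * R] (fun p => p.1) by exact: measurable_fst.
have m2 : measurable_fun [set: R * R] (fun p => p.2) by exact: measurable_snd.
have if0 (b : bool) z : (0 <= if b then phi z else 0)%E by case: ifP.
pose Q := (\int[leb]_x (phi x * (Num.max 0 x)%R%:E))%E; rewrite -/Q.
transitivity (\int[leb]_x \int[leb]_y (if ((- x <= y) && (y <= x))%R then phi x else 0)
  + \int[leb]_x \int[leb]_y (if ((- y <= x) && (x < y))%R then phi y else 0))%E.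
  rewrite -ge0_integralD//; last 4 first.
  - by move=> x _; exact: integral_ge0.
  - apply: (measurable_lebesgue_integral (f := fun x y =>
      if ((- x <= y) && (y <= x))%R then phi x else 0%E)) => //.
    apply: measurable_fun_if_comp => //; apply: measurable_and; apply: measurable_fun_ler => //.
    exact: measurable_funN.
  - by move=> x _; exact: integral_ge0.
  - apply: (measurable_lebesgue_integral (f := fun x y =>
      if ((- y <= x) && (x < y))%R then phi y else 0%E)) => //.
    apply: measurable_fun_if_comp => //; apply: measurable_and; last exact: measurable_fun_ltr.
    by apply: measurable_fun_ler => //; exact: measurable_funN.
  apply: eq_integral => x _.
  rewrite -ge0_integralD//; last 2 first.
  - apply: measurable_fun_ifT => //.
    by apply: measurable_and; exact: measurable_fun_ler.
  - apply: measurable_fun_ifT => //.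
    apply: measurable_and; last exact: measurable_fun_ltr.
    by apply: measurable_fun_ler => //; exact: measurable_funN.
  apply: eq_integral => y _.
  rewrite -[(- x <= y)%R]subr_ge0 -[(- y <= x)%R]subr_ge0 !opprK [(y + x)%R]addrC.
  case: (leP y x) => yx; first by rewrite andbT andbF adde0.
  by rewrite andbF andbT add0e.
have lebN b x : leb [set` Interval (BLeft (- x)) (BSide b x)] = (2%:R%:E * (Num.max 0 x)%R%:E)%E.
  rewrite !lebesgue_measure_itv /= !lte_fin -EFinM.
  rewrite (_ : (- x < x) = (0 < x)); last by apply/idP/idP => ?; lra.
  case: ltrP => _; last by rewrite mulr0.
  by rewrite -EFinB opprK mulr_natl mulr2n.
have -> : (\int[leb]_x \int[leb]_y
    (if ((- x <= y) && (y <= x))%R then phi x else 0) = 2%:R%:E * Q)%E.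
  rewrite -ge0_integralZl//; last 2 first.
  - exact: measurable_mul_max.
  - by move=> x _; rewrite mule_ge0// lee_fin le_max lexx.
  apply: eq_integral => x _.
  have E : [set y | (- x <= y <= x)%R] = `[- x, x]%classic.
    by apply/seteqP; split => y; rewrite /= in_itv.
  by rewrite integral_if_const ?E// (lebN false) muleCA.
have -> : (\int[leb]_x \int[leb]_y
    (if ((- y <= x) && (x < y))%R then phi y else 0) = 2%:R%:E * Q)%E.
  transitivity (\int[leb]_y \int[leb]_x
      (if ((- y <= x) && (x < y))%R then phi y else 0))%E.
    apply: (lebesgue_fubini (f := fun x y =>
      if ((- y <= x) && (x < y))%R then phi y else 0%E)) => //.
    apply: measurable_fun_if_comp => //; apply: measurable_and; last exact: measurable_fun_ltr.
    by apply: measurable_fun_ler => //; exact: measurable_funN.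
  rewrite -ge0_integralZl//; last 2 first.
  - exact: measurable_mul_max.
  - by move=> x _; rewrite mule_ge0// lee_fin le_max lexx.
  apply: eq_integral => y _ /=.
  have E : [set x | ((- y <= x) && (x < y))%R] = `[- y, y[%classic.
    by apply/seteqP; split => x; rewrite /= in_itv.
  by rewrite integral_if_const ?E// (lebN true) muleCA.
rewrite -ge0_muleDl//; congr (_ * _)%E.
by rewrite -EFinD -natrD.
Qed.

End PlaneIdentity.

(** * Potentials on a path and their region *)

Section PathRegion.
Variable R : realType.
Local Notation leb := (@lebesgue_measure R).
Local Notation Rt := (Rtuple R).
Implicit Types x y : nat -> R.

(** What is left at vertex [k] for the later edges once the earlier edges have
returned as much as they can. *)
Fixpoint potential x y (k : nat) : R :=
  if k is k'.+1 then x k + Num.min (potential x y k') (y k') else x 0%N.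

Definition admissible x y (n : nat) : bool :=
  all (fun k => 0 <= potential x y k + y k) (iota 0 n).

Definition excess x y (n : nat) : R := \sum_(k < n) Num.max (potential x y k) (y k).

(** By [max + min = sum], applied at each edge. *)
Lemma potential_sum x y n :
  \sum_(k < n.+1) x k + \sum_(k < n) y k = potential x y n + excess x y n.
Proof.
rewrite /excess; elim: n => [|n IH]; first by rewrite big_ord_recr !big_ord0 /= add0r.
rewrite [\sum_(k < n.+2) _]big_ord_recr [\sum_(k < n.+1) y k]big_ord_recr.
rewrite [in RHS]big_ord_recr /=.
have := addr_max_min (potential x y n) (y n).
rewrite addrACA IH; set M := Num.max _ _; set m := Num.min _ _ => Mm.
move: (potential x y n) (x n.+1) (y n) Mm => p a b Mm; lra.
Qed.

Lemma eq_potential x y x' y' k : (forall j, (j <= k)%N -> x j = x' j) ->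
  (forall j, (j < k)%N -> y j = y' j) -> potential x y k = potential x' y' k.
Proof.
elim: k => [|k IH] ex ey /=; first exact: ex.
rewrite ex// ey// IH// => j jk; [apply: ex|apply: ey]; lia.
Qed.

(** Tuples list the coordinates from the last edge down to the first vertex,
[y_(n-1), x_(n-1), ..., y_0, x_0], so that consing two entries lengthens the
path by one edge.  The default value 0 makes [x_n] vanish. *)
Definition path_x (t : seq R) (k : nat) : R := nth 0 (rev t) k.*2.
Definition path_y (t : seq R) (k : nat) : R := nth 0 (rev t) k.*2.+1.

Lemma path_x_cons n (t : n.*2.-tuple R) a b k : (k < n)%N ->
  path_x [:: b, a & t] k = path_x t k.
Proof.
by move=> kn; rewrite /path_x !rev_cons !nth_rcons !size_rcons size_rev size_tuple !ifT//; lia.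
Qed.

Lemma path_y_cons n (t : n.*2.-tuple R) a b k : (k < n)%N ->
  path_y [:: b, a & t] k = path_y t k.
Proof.
by move=> kn; rewrite /path_y !rev_cons !nth_rcons !size_rcons size_rev size_tuple !ifT//; lia.
Qed.

Lemma path_x_last n (t : n.*2.-tuple R) a b : path_x [:: b, a & t] n = a.
Proof.
rewrite /path_x !rev_cons !nth_rcons !size_rcons size_rev size_tuple ltnS leqnn.
by rewrite ltnn eqxx.
Qed.

Lemma path_y_last n (t : n.*2.-tuple R) a b : path_y [:: b, a & t] n = b.
Proof.
by rewrite /path_y !rev_cons !nth_rcons !size_rcons size_rev size_tuple ltnn eqxx.
Qed.

Lemma path_x_out n (t : n.*2.-tuple R) : path_x t n = 0.
Proof. by rewrite /path_x nth_default// size_rev size_tuple. Qed.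

Lemma potential_cons n (t : n.*2.-tuple R) a b k : (k < n)%N ->
  potential (path_x [:: b, a & t]) (path_y [:: b, a & t]) k =
  potential (path_x t) (path_y t) k.
Proof.
move=> kn; apply: eq_potential => j jk; first by rewrite path_x_cons//; lia.
by rewrite path_y_cons//; lia.
Qed.

(** The potential on the right is taken one step past the end of the tuple, where
[path_x] is 0; it is thus the minimum that is added to the new coordinate. *)
Lemma potential_last n (t : n.*2.-tuple R) a b :
  potential (path_x [:: b, a & t]) (path_y [:: b, a & t]) n =
  a + potential (path_x t) (path_y t) n.
Proof.
case: n t => [|n] t; first by rewrite /= path_x_last path_x_out addr0.
rewrite /= potential_cons// path_y_cons// path_x_out add0r; congr (_ + _).
exact: path_x_last.
Qed.

Lemma admissible_cons n (t : n.*2.-tuple R) a b :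
  admissible (path_x [:: b, a & t]) (path_y [:: b, a & t]) n.+1 =
  admissible (path_x t) (path_y t) n &&
  (0 <= a + potential (path_x t) (path_y t) n + b).
Proof.
rewrite /admissible -addn1 iotaD all_cat add0n [all _ (iota n 1)]/= andbT.
rewrite potential_last path_y_last; congr (_ && _).
apply: eq_in_all => k; rewrite mem_iota add0n => /andP[_ kn].
by rewrite potential_cons// path_y_cons.
Qed.

Lemma excess_cons n (t : n.*2.-tuple R) a b :
  excess (path_x [:: b, a & t]) (path_y [:: b, a & t]) n.+1 =
  excess (path_x t) (path_y t) n +
  Num.max (a + potential (path_x t) (path_y t) n) b.
Proof.
rewrite /excess big_ord_recr /= potential_last path_y_last; congr (_ + _).
by apply: eq_bigr => k _; rewrite potential_cons// path_y_cons.
Qed.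

Section Measurability.
Variable d : nat.

Lemma measurable_nth_rev j : measurable_fun [set: Rt d] (fun t : Rt d => nth (0 : R) (rev t) j).
Proof.
have [jd|dj] := ltnP j d; last first.
  rewrite (_ : (fun _ => _) = cst 0); first exact: measurable_cst.
  by apply/funext => t; rewrite nth_default// size_rev size_tuple.
have jd' : (d - j.+1 < d)%N by lia.
rewrite (_ : (fun _ => _) = (fun t : Rt d => tnth t (Ordinal jd'))); first exact: measurable_tnth.
by apply/funext => t; rewrite nth_rev size_tuple// (tnth_nth 0).
Qed.

Lemma measurable_potential k :
  measurable_fun [set: Rt d] (fun t : Rt d => potential (path_x t) (path_y t) k).
Proof.
elim: k => [|k IH] /=; first exact: measurable_nth_rev.
apply: measurable_funD; first exact: measurable_nth_rev.
by apply: measurable_minr => //; exact: measurable_nth_rev.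
Qed.

Lemma measurable_all (dT : measure_display) (T : measurableType dT) (I : Type) (r : seq I) (F : I -> T -> bool) :
  (forall i, measurable_fun setT (F i)) ->
  measurable_fun setT (fun t => all (F ^~ t) r).
Proof.
move=> mF; elim: r => [|i r IH] /=; first exact: measurable_cst.
exact: measurable_and.
Qed.

Lemma measurable_excess n :
  measurable_fun [set: Rt d] (fun t : Rt d => excess (path_x t) (path_y t) n).
Proof.
rewrite /excess; elim: n => [|n IH].
  by under eq_fun do rewrite big_ord0; exact: measurable_cst.
under eq_fun do rewrite big_ord_recr /=.
apply: measurable_funD => //; apply: measurable_maxr; first exact: measurable_potential.
exact: measurable_nth_rev.
Qed.

Lemma measurable_admissible n :
  measurable_fun [set: Rt d] (fun t : Rt d => admissible (path_x t) (path_y t) n).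
Proof.
apply: measurable_all => k; apply: measurable_fun_ler; first exact: measurable_cst.
by apply: measurable_funD; [exact: measurable_potential|exact: measurable_nth_rev].
Qed.

Lemma measurable_tuple_ge0 :
  measurable_fun [set: Rt d] (fun t : Rt d => all (fun z : R => 0 <= z) t).
Proof.
rewrite (_ : (fun _ => _) = (fun t : Rt d => all (fun i : 'I_d => 0 <= (tnth t i : R)) (enum 'I_d))).
  apply: measurable_all => k; apply: measurable_fun_ler; first exact: measurable_cst.
  exact: measurable_tnth.
apply/funext => t; apply/all_tnthP/allP => [h i _|h i]; first exact: h.
by apply: h; rewrite mem_enum.
Qed.

Lemma measurable_tuple_sum :
  measurable_fun [set: Rt d] (fun t : Rt d => \sum_(z <- t) (z : R)).
Proof.
under eq_fun do rewrite big_tuple.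
apply: (@measurable_sum _ _ _ _ _ _ (fun i (t : Rt d) => tnth t i : R)) => i.
exact: measurable_tnth.
Qed.

End Measurability.

(** Induction on [n], integrating over the last edge and vertex first: the
translation of the vertex coordinate by the incoming potential turns this inner
integral into the half plane integral, which is 4 times a quadrant integral.
The induction hypothesis is applied to the resulting function of the excess,
whence the need for an arbitrary [phi]. *)
Theorem integral_path_region n (phi : R -> \bar R) :
  measurable_fun setT phi -> (forall s, 0 <= phi s)%E ->
  (\int[@tuple_measure R n.*2]_t
     (if admissible (path_x t) (path_y t) n
      then phi (excess (path_x t) (path_y t) n) else 0) =
   (4 ^ n)%:R%:E * \int[@tuple_measure R n.*2]_t
     (if all (fun z : R => (0 <= z)%R) t then phi (\sum_(z <- t) (z : R))%R else 0))%E.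
Proof.
elim: n phi => [|n IH] phi mphi phi0.
  rewrite expn0 mul1e; apply: eq_integral => t _.
  by rewrite tuple0 /excess big_ord0 big_nil.
have if0 (b : bool) z : (0 <= if b then phi z else 0)%E by case: ifP.
(* the integral of [phi (e + x + y)] over the quadrant [x, y >= 0] *)
pose Psi (e : R) : \bar R := (\int[leb]_x (phi (e + x)%R * (Num.max 0 x)%R%:E))%E.
have mphie (e : R) : measurable_fun [set: R] (fun z => phi (e + z)%R).
  by apply: (measurableT_comp mphi); apply: measurable_funD => //; exact: measurable_cst.
have max0 (z : R) : (0 <= (Num.max 0 z)%R%:E)%E by rewrite lee_fin le_max lexx.
have Psi0 e : (0 <= Psi e)%E by apply: integral_ge0 => x _; rewrite mule_ge0.
have mPsi : measurable_fun setT Psi.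
  apply: (measurable_lebesgue_integral
    (f := fun e x : R => phi (e + x)%R * (Num.max 0 x)%R%:E)%E); last first.
    by move=> x y; rewrite mule_ge0.
  have m1 : measurable_fun [set: R * R] (fun p => p.1) by exact: measurable_fst.
  have m2 : measurable_fun [set: R * R] (fun p => p.2) by exact: measurable_snd.
  apply: emeasurable_funM.
    by apply: (measurableT_comp mphi); exact: measurable_funD.
  by apply/measurable_EFinP; apply: measurable_maxr => //; exact: measurable_cst.
pose F (t : Rt n.+1.*2) := (if admissible (path_x t) (path_y t) n.+1
  then phi (excess (path_x t) (path_y t) n.+1) else 0)%E.
pose G d (t : Rt d) := (if all (fun z : R => (0 <= z)%R) t
  then phi (\sum_(z <- t) (z : R))%R else 0)%E.
have mF : measurable_fun setT F.
  by apply: measurable_fun_if_comp => //; [exact: measurable_admissible|exact: measurable_excess].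
have mG d : measurable_fun setT (@G d).
  by apply: measurable_fun_if_comp => //; [exact: measurable_tuple_ge0|exact: measurable_tuple_sum].
have F0 t : (0 <= F t)%E by exact: if0.
have G0 d (t : Rt d) : (0 <= G d t)%E by exact: if0.
rewrite -[X in X = _]/(\int[_]_t F t)%E -[X in _ = (_ * X)%E]/(\int[_]_t @G n.+1.*2 t)%E.
have iter2 (H : Rt n.+1.*2 -> \bar R) : measurable_fun setT H -> (forall t, 0 <= H t)%E ->
  (\int[@tuple_measure R n.+1.*2]_t H t = \int[@tuple_measure R n.*2]_t \int[leb]_x
    \int[leb]_y H (Rtuple_cons (Rtuple_cons (t, x), y)))%E.
  move=> mH H0; rewrite (integral_tuple_cons mH)//.
  rewrite (@integral_tuple_cons _ _ (fun t => \int[leb]_y H (Rtuple_cons (t, y)))%E)//.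
  - exact: measurable_integral_cons.
  - by move=> t; exact: integral_ge0.
rewrite !iter2//.
transitivity (4%:R%:E * \int[@tuple_measure R n.*2]_t
  (if admissible (path_x t) (path_y t) n
      then Psi (excess (path_x t) (path_y t) n) else 0))%E.
  rewrite -ge0_integralZl//; last 2 first.
  - by apply: measurable_fun_if_comp => //; [exact: measurable_admissible|exact: measurable_excess].
  - by move=> t _; case: ifP.
  apply: eq_integral => t _.
  case: ifPn => adm; last first.
    rewrite mule0; apply: integral0_eq => x _; apply: integral0_eq => y _.
    by rewrite /F /= admissible_cons (negbTE adm).
  set e := excess _ _ _; set p := potential (path_x t) (path_y t) n.
  rewrite -(integral_halfplane_max (phi := fun z => phi (e + z)%R))//.
  rewrite -[RHS](integral_translation p); last 2 first.
  - apply: (measurable_lebesgue_integral (f := fun x y : R =>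
      if (0 <= x + y)%R then phi (e + Num.max x y)%R else 0%E)) => //.
    have m1 : measurable_fun [set: R * R] (fun p => p.1) by exact: measurable_fst.
    have m2 : measurable_fun [set: R * R] (fun p => p.2) by exact: measurable_snd.
    apply: measurable_fun_if_comp => //.
      by apply: measurable_fun_ler; [exact: measurable_cst|exact: measurable_funD].
    by apply: measurable_funD; [exact: measurable_cst|exact: measurable_maxr].
  - by move=> x; exact: integral_ge0.
  apply: eq_integral => x _; apply: eq_integral => y _.
  by rewrite /F /= admissible_cons adm /= excess_cons.
rewrite IH// muleA -EFinM -natrM -expnS; congr (_ * _)%E.
apply: eq_integral => t _.
transitivity (\int[leb]_x \int[leb]_y
  (if all (fun z : R => (0 <= z)%R) t && ((0 <= x) && (0 <= y))%R
  then phi (\sum_(z <- t) (z : R) + (x + y))%R else 0))%E; last first.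
  apply: eq_integral => x _; apply: eq_integral => y _.
  rewrite /G /= !big_cons andbC -andbA andbCA; congr (if _ then phi _ else _); ring.
case: ifPn => [tp|tn] /=; last first.
  by rewrite integral0_eq// => x _; apply: integral0_eq.
by rewrite (integral_quadrant_add (phi := fun z => phi (\sum_(z <- t) (z : R) + z)%R)).
Qed.

End PathRegion.

(** * The cone cut out by the potentials *)

Section Concavity.
Variable R : realType.
Implicit Types x y : nat -> R.

Lemma potential0 k : potential (fun _ => 0 : R) (fun _ => 0) k = 0.
Proof. by elim: k => //= k ->; rewrite minxx addr0. Qed.

Lemma potentialZ (c : R) x y k : 0 <= c ->
  potential (fun j => c * x j) (fun j => c * y j) k = c * potential x y k.
Proof.
move=> c0; elim: k => //= k ->; rewrite mulrDr; congr (_ + _).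
by rewrite minr_pMr.
Qed.

(** The minimum is superadditive. *)
Lemma potentialD x y x' y' k :
  potential x y k + potential x' y' k <=
  potential (fun j => x j + x' j) (fun j => y j + y' j) k.
Proof.
elim: k => //= k IH; rewrite addrACA lerD2l le_min; apply/andP; split.
  by apply: le_trans IH; apply: lerD; rewrite ge_min lexx.
by apply: lerD; rewrite ge_min lexx orbT.
Qed.

Definition path_cone (n : nat) x y :=
  (forall k, (k < n)%N -> 0 <= potential x y k + y k) /\ 0 <= potential x y n.

Lemma path_cone0 n : path_cone n (fun _ => 0) (fun _ => 0).
Proof. by split=> [k _|]; rewrite potential0 ?addr0. Qed.

Lemma path_coneZ n (c : R) x y : 0 <= c -> path_cone n x y ->
  path_cone n (fun j => c * x j) (fun j => c * y j).
Proof.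
move=> c0 [C0 Cn]; split=> [k kn|]; rewrite potentialZ//; last exact: mulr_ge0.
by rewrite -mulrDr mulr_ge0// C0.
Qed.

Lemma path_coneD n x y x' y' : path_cone n x y -> path_cone n x' y' ->
  path_cone n (fun j => x j + x' j) (fun j => y j + y' j).
Proof.
move=> [C0 Cn] [C0' Cn']; split=> [k kn|].
  apply: le_trans (lerD (potentialD x y x' y' k) (lexx _)).
  by rewrite addrACA addr_ge0 ?C0 ?C0'.
by apply: le_trans (potentialD _ _ _ _ _); rewrite addr_ge0.
Qed.

Lemma path_cone_ge0 n x y : (forall k, (k <= n)%N -> 0 <= x k) ->
  (forall k, (k < n)%N -> 0 <= y k) -> path_cone n x y.
Proof.
move=> x0 y0.
have p0 k : (k <= n)%N -> 0 <= potential x y k.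
  elim: k => /= [|k IH] kn; first exact: x0.
  by rewrite addr_ge0 ?x0// le_min IH ?y0//; lia.
by split=> [k kn|]; rewrite ?addr_ge0 ?p0 ?y0//; lia.
Qed.

(** The potential is 0 before vertex [k], equal to [u] at [k], and nonnegative
after [k], since no edge beyond [k] carries anything. *)
Lemma path_cone_edge n k (u v w : R) : (k < n)%N ->
  0 <= u + v -> 0 <= u + w -> 0 <= v + w ->
  path_cone n (fun j => u * (j == k)%:R + v * (j == k.+1)%:R)
              (fun j => w * (j == k)%:R).
Proof.
move=> kn uv uw vw.
set x := (fun j : nat => u * _ + _); set y := (fun j : nat => w * _).
have x_lt j : (j < k)%N -> x j = 0.
  by move=> jk; rewrite /x !ltn_eqF ?mulr0 ?addr0//; lia.
have y_neq j : j != k -> y j = 0 by move=> jk; rewrite /y (negbTE jk) mulr0.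
have pot j : [/\ (j < k)%N -> potential x y j = 0,
    j = k -> potential x y j = u & (k < j)%N -> 0 <= potential x y j].
  elim: j => [|j [IH1 IH2 IH3]] /=.
    split=> // [/x_lt//|k0].
    by rewrite /x -k0 mulr1 mulr0 addr0.
  split=> [jk|jk|].
  - rewrite x_lt// y_neq; last lia.
    by rewrite IH1 ?minxx ?addr0//; lia.
  - rewrite y_neq ?IH1; [|lia..].
    rewrite minxx addr0 /x jk eqxx mulr1 (_ : (k == k.+1) = false) ?mulr0 ?addr0//.
    lia.
  - rewrite ltnS leq_eqVlt => /orP[/eqP kj|kj].
      rewrite IH2//; rewrite /x /y -kj eqxx (_ : (k.+1 == k) = false); last lia.
      by rewrite !mulr1 mulr0 add0r eqxx mulr1 minEle; case: ifP; lra.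
    rewrite y_neq; last lia.
    rewrite /x !gtn_eqF ?mulr0 ?add0r; [|lia..].
    by rewrite le_min IH3/=.
split=> [j jn|]; last by have [_ _ ->] := pot n.
have [p1 p2 p3] := pot j; have [jk|jk|jk] := ltngtP j k.
- by rewrite p1// y_neq ?addr0//; lia.
- by rewrite y_neq ?addr0 ?p3//; lia.
- by rewrite p2// /y jk eqxx mulr1.
Qed.

End Concavity.

(** * Hulls of families indexed by a finite type *)

Section Hulls.
Variables (R : realType) (V : lmodType R).

Lemma conv_hull_fin (S : set V) (I : finType) (a : I -> R) (v : I -> V) :
  (forall i, 0 <= a i) -> \sum_i a i = 1 -> (forall i, S (v i)) ->
  conv_hull S (\sum_i a i *: v i).
Proof.
move=> a0 a1 Sv.
exists #|I|, (fun k => a (enum_val k)), (fun k => v (enum_val k)).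
have eb := onW_bij _ (@enum_val_bij I).
by split => //; rewrite -?a1 (reindex _ (eb _)).
Qed.

Lemma aff_hull_fin (S : set V) (I : finType) (a : I -> R) (v : I -> V) :
  \sum_i a i = 1 -> (forall i, S (v i)) -> aff_hull S (\sum_i a i *: v i).
Proof.
move=> a1 Sv.
exists #|I|, (fun k => a (enum_val k)), (fun k => v (enum_val k)).
have eb := onW_bij _ (@enum_val_bij I).
by split => //; rewrite -?a1 (reindex _ (eb _)).
Qed.

End Hulls.

(** * The cosmological polytope of a path *)

Section PathPolytope.
Variables (R : realType) (n : nat).
Local Notation G := (path_graph n).
Local Notation V := (cspace R G).

Lemma path_edge_subproof (i : 'I_n) :
  [set widen_ord (leqnSn n) i; lift ord0 i]%SET \in edges G.
Proof. exact: imset_f. Qed.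

Definition path_edge (i : 'I_n) : edge G :=
  exist (fun e : {set G} => e \in edges G) _ (path_edge_subproof i).

Lemma path_edge_inj : injective path_edge.
Proof.
move=> i j /(congr1 val) /= /setP E.
have := E (widen_ord (leqnSn n) i); have := E (lift ord0 i).
rewrite !inE !eqxx orbT /= -!val_eqE /= /bump /=.
move=> /esym h1 /esym h2; apply: val_inj => /=.
by move: h1 h2; lia.
Qed.

Lemma path_edge_surj (e : edge G) : exists i, e = path_edge i.
Proof. by case: e => A AE; have /imsetP[i _ Ai] := AE; exists i; exact: val_inj. Qed.

Definition vertex_coord (z : V) (k : nat) : R := z (inl (inord k)).
Definition edge_coord (z : V) (k : nat) : R :=
  if insub k is Some i then z (inr (path_edge i)) else 0.

Lemma vertex_coordE z (i : 'I_n.+1) : vertex_coord z i = z (inl i).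
Proof. by rewrite /vertex_coord inord_val. Qed.

Lemma edge_coordE z (i : 'I_n) : edge_coord z i = z (inr (path_edge i)).
Proof. by rewrite /edge_coord valK. Qed.

Definition coord_sum (z : V) : R := \sum_k (z k : R).

Lemma coord_sum_path z :
  coord_sum z = \sum_(k < n.+1) vertex_coord z k + \sum_(k < n) edge_coord z k.
Proof.
rewrite /coord_sum big_sumType /=; congr (_ + _).
  by apply: eq_bigr => i _; rewrite vertex_coordE.
rewrite (reindex path_edge) /=; last first.
  have [h hP] := choice path_edge_surj.
  exists h => [i _|e _]; last by rewrite -hP.
  by apply: path_edge_inj; rewrite -hP.
by apply: eq_bigr => i _; rewrite edge_coordE.
Qed.

Lemma cspace_eq (z z' : V) :
  (forall k, (k < n.+1)%N -> vertex_coord z k = vertex_coord z' k) ->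
  (forall k, (k < n)%N -> edge_coord z k = edge_coord z' k) -> z = z'.
Proof.
move=> ev ee; apply/ffunP => -[i|e].
  by rewrite -!vertex_coordE ev.
by have [k ->] := path_edge_surj e; rewrite -!edge_coordE ee.
Qed.

Definition in_path_cone (z : V) : Prop := path_cone n (vertex_coord z) (edge_coord z).

Lemma eq_path_cone x y x' y' : (forall k, (k <= n)%N -> x k = x' k) ->
  (forall k, (k < n)%N -> y k = y' k :> R) -> path_cone n x y -> path_cone n x' y'.
Proof.
move=> ex ey [C0 Cn].
have pE k : (k <= n)%N -> potential x y k = potential x' y' k.
  by move=> kn; apply: eq_potential => j jk; [apply: ex|apply: ey]; lia.
split=> [k kn|]; last by rewrite -pE.
by rewrite -pE ?(ltnW kn)// -ey// C0.
Qed.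

Lemma vertex_coordD z z' k : vertex_coord (z + z') k = vertex_coord z k + vertex_coord z' k.
Proof. by rewrite /vertex_coord ffunE. Qed.

Lemma vertex_coordZ (c : R) z k : vertex_coord (c *: z) k = c * vertex_coord z k.
Proof. by rewrite /vertex_coord ffunE. Qed.

Lemma edge_coordD z z' k : edge_coord (z + z') k = edge_coord z k + edge_coord z' k.
Proof. by rewrite /edge_coord; case: insubP => [i _ _|_]; rewrite ?ffunE ?addr0. Qed.

Lemma edge_coordZ (c : R) z k : edge_coord (c *: z) k = c * edge_coord z k.
Proof. by rewrite /edge_coord; case: insubP => [i _ _|_]; rewrite ?ffunE ?mulr0. Qed.

Lemma in_path_cone_sum (I : finType) (a : I -> R) (v : I -> V) :
  (forall i, 0 <= a i) -> (forall i, in_path_cone (v i)) ->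
  in_path_cone (\sum_i a i *: v i).
Proof.
move=> a0 Cv; elim/big_ind : _ => [|z z' Cz Cz'|i _].
- apply: eq_path_cone (@path_cone0 R n) => k kn; rewrite /vertex_coord /edge_coord ?ffunE//.
  by case: insubP => // i _ _; rewrite ffunE.
- by apply: eq_path_cone (path_coneD Cz Cz') => k kn; rewrite ?vertex_coordD ?edge_coordD.
- by apply: eq_path_cone (path_coneZ (a0 i) (Cv i)) => k kn; rewrite ?vertex_coordZ ?edge_coordZ.
Qed.

Lemma coord_sum_sum (I : finType) (a : I -> R) (v : I -> V) :
  coord_sum (\sum_i a i *: v i) = \sum_i a i * coord_sum (v i).
Proof.
rewrite /coord_sum; under [RHS]eq_bigr do rewrite mulr_sumr.
rewrite exchange_big; apply: eq_bigr => k _ /=.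
by rewrite sum_ffunE; apply: eq_bigr => i _; rewrite ffunE.
Qed.

Lemma coord_sumD z z' : coord_sum (z + z') = coord_sum z + coord_sum z'.
Proof. by rewrite /coord_sum -big_split; apply: eq_bigr => k _; rewrite ffunE. Qed.

Lemma coord_sumZ (c : R) z : coord_sum (c *: z) = c * coord_sum z.
Proof. by rewrite /coord_sum mulr_sumr; apply: eq_bigr => k _; rewrite ffunE. Qed.

Lemma coord_sum_xvec k : coord_sum (@xvec R G k) = 1.
Proof.
rewrite /coord_sum (bigD1 k)//= ffunE eqxx big1 ?addr0// => j /negbTE jk.
by rewrite ffunE jk.
Qed.

Local Notation vtx i := (inl i : (G + edge G)%type).
Local Notation edg k := (inr (path_edge k) : (G + edge G)%type).
Local Notation src k := (widen_ord (leqnSn n) k).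
Local Notation tgt k := (lift ord0 k).

Definition edge_vec (k : 'I_n) (u v w : R) : V :=
  u *: xvec R (vtx (src k)) + v *: xvec R (vtx (tgt k)) + w *: xvec R (edg k).

Lemma edge_vecE k u v w l : edge_vec k u v w l =
  u * (l == vtx (src k))%:R + v * (l == vtx (tgt k))%:R + w * (l == edg k)%:R.
Proof.
have lin3E (a b c : V) : (u *: a + v *: b + w *: c) l = u * a l + v * b l + w * c l.
  by rewrite !ffunE.
have xvecE m : xvec R m l = (l == m)%:R by rewrite ffunE.
by rewrite /edge_vec lin3E !xvecE.
Qed.

Lemma vertex_coord_edge_vec k u v w j : (j <= n)%N ->
  vertex_coord (edge_vec k u v w) j = u * (j == k)%:R + v * (j == k.+1)%:R.
Proof.
move=> jn; have jn' : (j < n.+1)%N by [].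
rewrite (vertex_coordE _ (Ordinal jn')) edge_vecE.
by rewrite /eq_op /= mulr0 addr0.
Qed.

Lemma edge_coord_edge_vec k u v w j : (j < n)%N ->
  edge_coord (edge_vec k u v w) j = w * (j == k)%:R.
Proof.
move=> jn; rewrite (edge_coordE _ (Ordinal jn)) edge_vecE !mulr0 !add0r; congr (w * _%:R).
by rewrite (inj_eq (@inr_inj _ _)) (inj_eq path_edge_inj).
Qed.

Lemma in_path_cone_edge_vec k u v w : 0 <= u + v -> 0 <= u + w -> 0 <= v + w ->
  in_path_cone (edge_vec k u v w).
Proof.
move=> uv uw vw; apply: eq_path_cone (path_cone_edge (ltn_ord k) uv uw vw) => j jn.
  by rewrite vertex_coord_edge_vec.
by rewrite edge_coord_edge_vec.
Qed.

Lemma coord_sum_edge_vec k u v w : coord_sum (edge_vec k u v w) = u + v + w.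
Proof.
have coord_sum_lin3 (a b c : V) :
    coord_sum (u *: a + v *: b + w *: c) = u * coord_sum a + v * coord_sum b + w * coord_sum c.
  by rewrite !coord_sumD !coord_sumZ.
rewrite /edge_vec coord_sum_lin3.
by congr (_ + _ + _); rewrite -[RHS]mulr1; congr (_ * _); exact: coord_sum_xvec.
Qed.

Definition path_generators : set V :=
  [set z | exists k, [\/ z = edge_vec k 1 1 (- 1), z = edge_vec k 1 (- 1) 1
                      | z = edge_vec k (- 1) 1 1]].

(** Swapping the two ends of an edge permutes its three generators. *)
Lemma path_cosmologicalE :
  @cosmological_polytope R G = conv_hull path_generators.
Proof.
rewrite /cosmological_polytope; congr conv_hull.
have lin1 (a b c : V) : 1 *: a + 1 *: b + (- 1) *: c = a + b - c.
  by rewrite scaleN1r !scale1r.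
have lin2 (a b c : V) : 1 *: a + (- 1) *: b + 1 *: c = a - b + c.
  by rewrite scaleN1r !scale1r.
have lin3 (a b c : V) : (- 1) *: a + 1 *: b + 1 *: c = - a + b + c.
  by rewrite scaleN1r !scale1r.
apply/seteqP; split => z /=; last first.
  move=> [k zk]; exists (src k), (tgt k), (path_edge k); split => //.
    by rewrite -val_eqE /= /bump /=; lia.
  by case: zk => ->; [constructor 1; exact: lin1|constructor 2; exact: lin2
    |constructor 3; exact: lin3].
move=> [i [j [e [ij]]]]; have [k -> /=] := path_edge_surj e.
move=> /setP E zE; exists k.
have iE : (i == src k) || (i == tgt k) by have := E i; rewrite !inE eqxx => ->.
have jE : (j == src k) || (j == tgt k) by have := E j; rewrite !inE eqxx orbT => ->.
have [ik|ik] := eqVneq i (src k); have [jk|jk] := eqVneq j (src k).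
- by move: ij; rewrite ik jk eqxx.
- move: jE zE; rewrite (negbTE jk) ik /= => /eqP ->.
  case=> ->; [constructor 1|constructor 2|constructor 3].
  + by rewrite /edge_vec lin1.
  + by rewrite /edge_vec lin2.
  + by rewrite /edge_vec lin3.
- move: iE zE; rewrite (negbTE ik) jk /= => /eqP ->.
  case=> ->; [constructor 1|constructor 3|constructor 2].
  + by rewrite /edge_vec lin1; congr (_ - _); exact: addrC.
  + by rewrite /edge_vec lin3; congr (_ + _); exact: addrC.
  + by rewrite /edge_vec lin2; congr (_ + _); exact: addrC.
- by move: iE jE ij; rewrite (negbTE ik) (negbTE jk) /= => /eqP -> /eqP ->; rewrite eqxx.
Qed.

Lemma conv_hull_coord_sum z : conv_hull path_generators z -> coord_sum z = 1 /\ in_path_cone z.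
Proof.
move=> [m [a [v [a0 a1 Sv ->]]]]; split.
  rewrite coord_sum_sum -[RHS]a1; apply: eq_bigr => i _.
  suff -> : coord_sum (v i) = 1 by rewrite mulr1.
  by have [k [] ->] := Sv i; rewrite coord_sum_edge_vec; lra.
apply: in_path_cone_sum => // i.
by have [k [] ->] := Sv i; apply: in_path_cone_edge_vec; lra.
Qed.

(** The cone [u + v, u + w, v + w >= 0] is simplicial: these three forms are
twice the coordinates on its generators. *)
Definition triangle_coef (u v w : R) (c : 'I_3) : R :=
  tnth [tuple (u + v) / 2; (u + w) / 2; (v + w) / 2] c.

Definition triangle_vertex (k : 'I_n) (c : 'I_3) : V :=
  tnth [tuple edge_vec k 1 1 (- 1); edge_vec k 1 (- 1) 1; edge_vec k (- 1) 1 1] c.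

Lemma sum_I3 (M : nmodType) (F : 'I_3 -> M) :
  \sum_c F c = F ord0 + F (lift ord0 ord0) + F ord_max.
Proof.
rewrite !big_ord_recl big_ord0 addr0 addrA; congr (_ + F _).
exact: val_inj.
Qed.

Lemma edge_vec_split k u v w :
  edge_vec k u v w = \sum_c triangle_coef u v w c *: triangle_vertex k c.
Proof.
rewrite sum_I3 /triangle_coef /triangle_vertex !(tnth_nth 0) /=.
have lin (a b c : V) : u *: a + v *: b + w *: c =
  ((u + v) / 2) *: (1 *: a + 1 *: b + (- 1) *: c) +
  ((u + w) / 2) *: (1 *: a + (- 1) *: b + 1 *: c) +
  ((v + w) / 2) *: ((- 1) *: a + 1 *: b + 1 *: c).
  by apply/ffunP => l; rewrite !ffunE /GRing.scale /=; field.
by rewrite /edge_vec lin.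
Qed.

(** The share of vertex [k+1] that goes to edge [k].  For [k+1 < n] it is
[- min (w_k, y_k)], in a form that also fits the last edge, which gets all of
vertex [n]. *)
Definition split_v (z : V) (k : nat) : R := vertex_coord z k.+1 -
  (if (k.+1 < n)%N then potential (vertex_coord z) (edge_coord z) k.+1 else 0).

Lemma edge_decomposition z : (0 < n)%N -> z = \sum_(k < n)
  edge_vec k (potential (vertex_coord z) (edge_coord z) k) (split_v z k) (edge_coord z k).
Proof.
move=> n0; set pot := potential _ _.
have vsum (I : finType) (F : I -> V) j : vertex_coord (\sum_i F i) j = \sum_i vertex_coord (F i) j.
  by rewrite /vertex_coord sum_ffunE.
have esum (I : finType) (F : I -> V) j : (j < n)%N ->
    edge_coord (\sum_i F i) j = \sum_i edge_coord (F i) j.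
  move=> jn; rewrite (edge_coordE _ (Ordinal jn)) sum_ffunE.
  by apply: eq_bigr => i _; rewrite (edge_coordE _ (Ordinal jn)).
apply: cspace_eq => j jn.
  rewrite vsum; under eq_bigr do rewrite vertex_coord_edge_vec//.
  rewrite big_split /=.
  have -> : \sum_(i < n) pot i * (j == i)%:R = if (j < n)%N then pot j else 0.
    case: ifPn => [jn'|jn'].
      rewrite (bigD1 (Ordinal jn'))//= eqxx mulr1 big1 ?addr0// => i ij.
      by rewrite (_ : (j == i) = false) ?mulr0//; apply/negbTE; move: ij; rewrite -val_eqE /= eq_sym.
    by rewrite big1// => i _; rewrite gtn_eqF ?mulr0//; have := ltn_ord i; lia.
  case: j jn => [|j] jn.
    by rewrite n0 big1 ?addr0// => i _; rewrite mulr0.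
  rewrite ltnS in jn; rewrite (bigD1 (Ordinal jn))//= eqxx mulr1 big1 ?addr0; last first.
    move=> i ij; rewrite (_ : (j.+1 == i.+1) = false) ?mulr0//; apply/negbTE; move: ij.
    by rewrite -val_eqE /= eqSS eq_sym.
  rewrite /split_v -/pot; case: ifP => _; last by rewrite add0r subr0.
  by rewrite addrC subrK.
rewrite esum//; under eq_bigr do rewrite edge_coord_edge_vec//.
rewrite (bigD1 (Ordinal jn))//= eqxx mulr1 big1 ?addr0// => i ij.
by rewrite (_ : (j == i) = false) ?mulr0//; apply/negbTE; move: ij; rewrite -val_eqE /= eq_sym.
Qed.

(** Each edge contribution of [edge_decomposition] is in the cone over its
triangle.  The generators have coordinate sum 1, so the coefficients add up to
the coordinate sum of [z]. *)
Lemma coord_sum_cone_conv_hull z : (0 < n)%N ->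
  coord_sum z = 1 -> in_path_cone z -> conv_hull path_generators z.
Proof.
move=> n0 tz [C0 Cn]; set pot := potential _ _ in C0 Cn.
have zE := edge_decomposition z n0; rewrite -/pot in zE.
set coef := fun p : 'I_n * 'I_3 =>
  triangle_coef (pot p.1) (split_v z p.1) (edge_coord z p.1) p.2.
have zE2 : z = \sum_p coef p *: triangle_vertex p.1 p.2.
  rewrite {1}zE -(pair_bigA _ (fun k c => coef (k, c) *: triangle_vertex k c)).
  by apply: eq_bigr => k _; rewrite edge_vec_split.
have tvP k c : path_generators (triangle_vertex k c).
  exists k; rewrite /triangle_vertex (tnth_nth 0).
  by case: c => [[|[|[|c]]] ic] //=; [constructor 1|constructor 2|constructor 3].
have tv k c : coord_sum (triangle_vertex k c) = 1.
  by have [l [] ->] := tvP k c; rewrite coord_sum_edge_vec; lra.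
rewrite zE2; apply: conv_hull_fin => [[k c]||p]; last exact: tvP; last first.
  by rewrite -[RHS]tz [in RHS]zE2 coord_sum_sum; apply: eq_bigr => p _; rewrite tv mulr1.
have kn := ltn_ord k; rewrite /coef /=.
have uw := C0 _ kn; set u := pot k in uw *; set w := edge_coord z k in uw *.
have q_ge0 (j : nat) : (j < n)%N -> (if (j.+1 < n)%N then 0 else pot j.+1) >= 0.
  move=> jn; case: ltnP => // nj.
  by rewrite (_ : j.+1 = n)//; lia.
have vE : split_v z k = (if (k.+1 < n)%N then 0 else pot k.+1) - Num.min u w.
  rewrite /split_v -/pot.
  have -> : pot k.+1 = vertex_coord z k.+1 + Num.min u w by [].
  by case: ifP => _; ring.
have qk := q_ge0 _ kn.
have mu : Num.min u w <= u by rewrite ge_min lexx.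
have mw : Num.min u w <= w by rewrite ge_min lexx orbT.
have uv : 0 <= u + split_v z k by rewrite vE; lra.
have vw : 0 <= split_v z k + w by rewrite vE; lra.
rewrite /triangle_coef (tnth_nth 0).
by case: c => [[|[|[|c]]] ic] //=; rewrite divr_ge0.
Qed.

Lemma path_polytopeE z : (0 < n)%N ->
  @cosmological_polytope R G z <-> coord_sum z = 1 /\ in_path_cone z.
Proof.
move=> n0; rewrite path_cosmologicalE; split; first exact: conv_hull_coord_sum.
by case; exact: coord_sum_cone_conv_hull.
Qed.

Lemma xvec_sum (z : V) : z = \sum_k (z k : R) *: xvec R (k : (G + edge G)%type).
Proof.
apply/ffunP => l; rewrite sum_ffunE (bigD1 l)//= big1 => [|k kl]; rewrite !ffunE.
  by rewrite eqxx addr0 [RHS]mulr1.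
by rewrite eq_sym (negbTE kl) [LHS]mulr0.
Qed.

(** The basis vectors belong to the polytope. *)
Lemma path_polytope_aff_hull : (0 < n)%N ->
  aff_hull (@cosmological_polytope R G) = [set z | coord_sum z = 1].
Proof.
move=> n0; apply/seteqP; split => z /=.
  move=> [m [a [v [a1 Sv ->]]]]; rewrite coord_sum_sum -[RHS]a1.
  apply: eq_bigr => i _; have [-> _] := (path_polytopeE _ n0).1 (Sv i).
  by rewrite mulr1.
move=> tz; rewrite [z]xvec_sum; apply: aff_hull_fin => // k.
apply/path_polytopeE => //; split; first exact: coord_sum_xvec.
apply: path_cone_ge0 => j jn.
  by rewrite /vertex_coord ffunE.
by rewrite (edge_coordE _ (Ordinal jn)) ffunE.
Qed.

Lemma chart_index_subproof (i : 'I_n.*2) : ((n.*2 - i.+1)./2 < n)%N.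
Proof. by have := ltn_ord i; lia. Qed.

(** The order of the coordinates that [path_x] and [path_y] expect: position [i]
holds the coordinate number [n.*2 - i.+1] of [x_0, y_0, x_1, y_1, ...]. *)
Definition chart_index (i : 'I_n.*2) : (G + edge G)%type :=
  let j := Ordinal (chart_index_subproof i) in
  if odd (n.*2 - i.+1) then edg j else vtx (src j).

(** Dropping [x_n] identifies the hyperplane of coordinate sum 1 with R^(2n). *)
Definition chart (z : V) : Rtuple R n.*2 := [tuple (z (chart_index i) : R) | i < n.*2].

Lemma path_x_chart z k : (k < n)%N -> path_x (chart z) k = vertex_coord z k.
Proof.
move=> kn; have k2 : (k.*2 < n.*2)%N by lia.
rewrite /path_x nth_rev size_tuple// -(tnth_nth _ _ (rev_ord (Ordinal k2))) tnth_mktuple.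
have -> : chart_index (rev_ord (Ordinal k2)) = vtx (src (Ordinal kn)).
  by rewrite /chart_index ifF; [congr inl; apply: val_inj => /=; lia|rewrite /=; lia].
by rewrite -vertex_coordE.
Qed.

Lemma path_y_chart z k : (k < n)%N -> path_y (chart z) k = edge_coord z k.
Proof.
move=> kn; have k2 : (k.*2.+1 < n.*2)%N by lia.
rewrite /path_y nth_rev size_tuple// -(tnth_nth _ _ (rev_ord (Ordinal k2))) tnth_mktuple.
have -> : chart_index (rev_ord (Ordinal k2)) = edg (Ordinal kn).
  by rewrite /chart_index ifT; [congr (edg _); apply: val_inj => /=; lia|rewrite /=; lia].
by rewrite -edge_coordE.
Qed.

End PathPolytope.

(** * The frame given by the coordinates other than the last vertex *)

Section PathChart.
Variables (R : realType) (n : nat).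
Local Notation G := (path_graph n).
Local Notation V := (cspace R G).
Local Notation vtx i := (inl i : (G + edge G)%type).
Local Notation edg k := (inr (path_edge k) : (G + edge G)%type).
Local Notation src k := (widen_ord (leqnSn n) k).
Local Notation P := (@cosmological_polytope R G).
Local Notation L := (@integer_lattice R G).

Lemma chart_inj (z z' : V) : coord_sum z = coord_sum z' -> chart z = chart z' -> z = z'.
Proof.
move=> tzz' czz'.
have ex k : (k < n)%N -> vertex_coord z k = vertex_coord z' k.
  by move=> kn; rewrite -!path_x_chart// czz'.
have ey k : (k < n)%N -> edge_coord z k = edge_coord z' k.
  by move=> kn; rewrite -!path_y_chart// czz'.
apply: cspace_eq => // k; rewrite ltnS leq_eqVlt => /orP[/eqP ->|]; last exact: ex.
move: tzz'; rewrite !coord_sum_path !(big_ord_recr n).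
rewrite (eq_bigr (fun i : 'I_n => vertex_coord z' i)) => [|i _]; last exact: (ex i (ltn_ord i)).
rewrite [X in _ + X = _](eq_bigr (fun i : 'I_n => edge_coord z' i)) => [|i _]; last exact: (ey i (ltn_ord i)).
by move/addIr/addrI.
Qed.

Definition chart_region : set (Rtuple R n.*2) :=
  [set t | admissible (path_x t) (path_y t) n /\ excess (path_x t) (path_y t) n <= 1].

(** By [potential_sum], [w_n >= 0] says that the excess is at most 1. *)
Lemma path_polytope_chart (z : V) : (0 < n)%N -> coord_sum z = 1 ->
  P z <-> chart_region (chart z).
Proof.
move=> n0 tz.
have pE k : (k < n)%N ->
    potential (path_x (chart z)) (path_y (chart z)) k =
    potential (vertex_coord z) (edge_coord z) k.
  by move=> kn; apply: eq_potential => j jk; rewrite ?path_x_chart ?path_y_chart//; lia.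
have aE : admissible (path_x (chart z)) (path_y (chart z)) n <->
    forall k, (k < n)%N -> 0 <= potential (vertex_coord z) (edge_coord z) k + edge_coord z k.
  split=> [/allP adm k kn|C0].
    by have := adm k; rewrite mem_iota add0n pE// path_y_chart//; exact.
  by apply/allP => k; rewrite mem_iota add0n => /andP[_ kn]; rewrite pE// path_y_chart// C0.
have eE : excess (path_x (chart z)) (path_y (chart z)) n =
    excess (vertex_coord z) (edge_coord z) n.
  by apply: eq_bigr => k _; rewrite pE// path_y_chart.
have sE : potential (vertex_coord z) (edge_coord z) n +
    excess (vertex_coord z) (edge_coord z) n = 1.
  by rewrite -potential_sum -coord_sum_path.
rewrite path_polytopeE// /chart_region /= eE /in_path_cone /path_cone aE.
split=> [[_ [C0 Cn]]|[C0 e1]]; first by split => //; lra.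
by split=> //; split => //; lra.
Qed.

Lemma cspace_frame_mapE d (p : V) (b : 'I_d -> V) t l :
  frame_map p b t l = p l + \sum_i (tnth t i : R) * b i l.
Proof.
rewrite /frame_map ffunE sum_ffunE; congr (_ + _).
by apply: eq_bigr => i _; rewrite ffunE.
Qed.

Lemma tnth_chart (z : V) i : tnth (chart z) i = z (chart_index i).
Proof. by rewrite tnth_mktuple. Qed.

Lemma chart_index_inj : injective (@chart_index n).
Proof.
move=> i j; rewrite /chart_index.
have := ltn_ord i; have := ltn_ord j.
case: ifP => oi; case: ifP => oj //= jn il.
  move=> e; have /(congr1 val) /= ij := path_edge_inj (inr_inj e).
  by apply: val_inj => /=; lia.
by move=> e; have /(congr1 val) /= ij := inl_inj e; apply: val_inj => /=; lia.
Qed.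

Lemma chart_index_neq i : (chart_index i == vtx ord_max) = false.
Proof.
rewrite /chart_index; case: ifP => // _; apply/negbTE.
rewrite (inj_eq (@inl_inj _ _)) -val_eqE /= neq_ltn.
by rewrite chart_index_subproof.
Qed.

Definition chart_base : V := xvec R (vtx ord_max).
Definition chart_vec (i : 'I_n.*2) : V := xvec R (chart_index i) - xvec R (vtx ord_max).

Lemma coord_sum_frame_map d (p : V) (b : 'I_d -> V) t :
  coord_sum (frame_map p b t) = coord_sum p + \sum_i (tnth t i : R) * coord_sum (b i).
Proof. by rewrite /frame_map coord_sumD coord_sum_sum. Qed.

Lemma coord_sumB (z z' : V) : coord_sum (z - z') = coord_sum z - coord_sum z'.
Proof. by rewrite coord_sumD -scaleN1r coord_sumZ mulN1r. Qed.

Lemma coord_sum_chart_frame t : coord_sum (frame_map chart_base chart_vec t) = 1.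
Proof.
rewrite coord_sum_frame_map big1 ?addr0; first exact: coord_sum_xvec.
move=> i _; rewrite coord_sumB; have h := @coord_sum_xvec R n.
by rewrite (h (chart_index i)) (h (vtx ord_max)) subrr mulr0.
Qed.

Lemma chart_frame_mapK t : chart (frame_map chart_base chart_vec t) = t.
Proof.
apply: eq_from_tnth => i; rewrite tnth_chart cspace_frame_mapE.
have xE k l : xvec R (k : (G + edge G)%type) l = (l == k)%:R by rewrite ffunE.
have vE j : chart_vec j (chart_index i) = (i == j)%:R.
  rewrite /chart_vec.
  have subE (f g : V) l : (f - g) l = f l - g l by rewrite !ffunE.
  by rewrite subE !xE chart_index_neq subr0 (inj_eq chart_index_inj).
rewrite /chart_base xE chart_index_neq add0r (bigD1 i)//= vE eqxx mulr1.
by rewrite big1 ?addr0// => j ji; rewrite vE eq_sym (negbTE ji) mulr0.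
Qed.

Lemma chartK (z : V) : coord_sum z = 1 -> frame_map chart_base chart_vec (chart z) = z.
Proof.
move=> tz; apply: chart_inj; last exact: chart_frame_mapK.
by rewrite coord_sum_chart_frame tz.
Qed.

Lemma chart_lattice_frame : (0 < n)%N -> lattice_frame L P chart_base chart_vec.
Proof.
move=> n0; split.
- exact: (can_inj chart_frame_mapK).
- rewrite path_polytope_aff_hull//; apply/seteqP; split => z /=.
    by move=> tz; exists (chart z) => //; exact: chartK.
  by move=> [t _ <-]; exact: coord_sum_chart_frame.
- rewrite path_polytope_aff_hull//; apply/seteqP; split => z /=.
    move=> [Lz tz]; exists (chart z); last exact: chartK.
    by move=> i; rewrite tnth_chart; exact: Lz.
  move=> [t tint <-]; split; last exact: coord_sum_chart_frame.
  move=> l; rewrite cspace_frame_mapE.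
  have xint k : (xvec R (k : (G + edge G)%type) l : R) \is a Num.int.
    by rewrite ffunE; case: (_ == _).
  have vint i : (chart_vec i l : R) \is a Num.int.
    rewrite /chart_vec.
    have subE (f g : V) : (f - g) l = f l - g l by rewrite !ffunE.
    by rewrite subE rpredB// xint.
  rewrite rpredD ?rpred_sum//; first exact: xint.
  by move=> i _; rewrite rpredM.
Qed.

End PathChart.

(** * Independence of the frame *)

(** Two dimensions, because for the coordinate change between two frames their
equality has to be proved and does not hold by conversion. *)
Lemma tuple_measure_lattice_iso (R : realType) (d m : nat) (g : Rtuple R d -> Rtuple R m)
    (f : {ffun 'I_d -> int} -> {ffun 'I_m -> int}) :
  d = m -> measurable_fun setT g -> bijective f ->
  (forall s, exists u, forall t, tuple_add (g t) s = g (tuple_add t u)) ->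
  (forall t k, g (tuple_add t (int_tuple R k)) = tuple_add (g t) (int_tuple R (f k))) ->
  forall A, measurable A -> tuple_measure (g @^-1` A) = tuple_measure A.
Proof. by move=> dm; move: g f; rewrite -dm => g f; exact: tuple_measure_lattice_map. Qed.

Section FrameInvariance.
Variables (R : realType) (n : nat).
Local Notation G := (path_graph n).
Local Notation V := (cspace R G).
Local Notation P := (@cosmological_polytope R G).
Local Notation L := (@integer_lattice R G).
Hypothesis n0 : (0 < n)%N.
Variables (d : nat) (p : V) (b : 'I_d -> V).
Hypothesis frame : lattice_frame L P p b.
Local Notation f := (frame_map p b).
Local Notation std := (frame_map (@chart_base R n) (@chart_vec R n)).

Let f_inj : injective f.
Proof. by case: frame. Qed.

Let f_range z : coord_sum z = 1 <-> exists t, f t = z.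
Proof.
case: frame => _; rewrite path_polytope_aff_hull// => /seteqP[h1 h2] _.
by split=> [/h1[t _]|[t tz]]; [exists t|apply: h2; exists t].
Qed.

Let f_sum t : coord_sum (f t) = 1.
Proof. by apply/f_range; exists t. Qed.

Let f_int z : L z -> coord_sum z = 1 ->
  exists k, f (int_tuple R k) = z.
Proof.
move=> Lz sz; case: frame => _ _; rewrite path_polytope_aff_hull// => /seteqP[h1 _].
have [|t tint tz] := h1 z; first by [].
exists [ffun i => Num.floor (tnth t i : R)]; rewrite -tz; congr f.
by apply: eq_from_tnth => i; rewrite tnth_mktuple ffunE floorK.
Qed.

Let int_f k : L (f (int_tuple R k)).
Proof.
case: frame => _ _; rewrite path_polytope_aff_hull// => /seteqP[_ h2].
have [] // := h2 (f (int_tuple R k)); exists (int_tuple R k) => // i.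
by rewrite tnth_mktuple intr_int.
Qed.

Let g t := chart (f t).

Let gE t i : tnth (g t) i = p (chart_index i) + \sum_j (tnth t j : R) * b j (chart_index i).
Proof. by rewrite tnth_chart cspace_frame_mapE. Qed.

Let std_g t : std (g t) = f t.
Proof. exact/chartK/f_sum. Qed.

Let g_inj : injective g.
Proof. by move=> t u /(congr1 (fun s => std s)); rewrite !std_g; exact: f_inj. Qed.

Let g_surj s : exists t, g t = s.
Proof.
have [|t tE] := (f_range (std s)).1; first exact: coord_sum_chart_frame.
by exists t; rewrite /g tE chart_frame_mapK.
Qed.

Let B : 'M[R]_(d, n.*2) := \matrix_(j, i) (b j (chart_index i) : R).

Definition tuple_of_row m (u : 'rV[R]_m) : Rtuple R m := [tuple (u ord0 i : R) | i < m].

Let g_row u v i : tnth (g (tuple_of_row (u + v))) i =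
  (tnth (g (tuple_of_row u)) i : R) + (v *m B) ord0 i.
Proof.
rewrite !gE -addrA; congr (_ + _); rewrite mxE -big_split /=.
by apply: eq_bigr => j _; rewrite !tnth_mktuple !mxE mulrDl.
Qed.

(** In the standard coordinates the linear part of a frame is both row free and
row full. *)
Lemma frame_dim : d = n.*2.
Proof.
have Bfree : row_free B.
  apply: inj_row_free => v vB.
  have /g_inj : g (tuple_of_row (0 + v)) = g (tuple_of_row 0).
    by apply: eq_from_tnth => i; rewrite g_row vB mxE addr0.
  move=> /(congr1 (fun t : Rtuple R d => tnth t)) e.
  apply/rowP => j; have := congr1 (fun h => h j) e.
  by rewrite !tnth_mktuple add0r mxE.
have Bfull : row_full B.
  rewrite -sub1mx; apply/row_subP => i; rewrite row1; apply/submxP.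
  have [t tE] := g_surj [tuple (tnth (g (tuple_of_row 0)) j : R) + (i == j)%:R | j < n.*2].
  exists (\row_j (tnth t j : R)).
  apply/rowP => j; have := g_row 0 (\row_j (tnth t j : R)) j.
  rewrite add0r (_ : tuple_of_row _ = t); last first.
    by apply: eq_from_tnth => l; rewrite tnth_mktuple mxE.
  by rewrite tE tnth_mktuple => /addrI <-; rewrite mxE eqxx eq_sym.
by move: Bfree Bfull => /eqP r1 /eqP r2; exact: etrans (esym r1) r2.
Qed.

Lemma measurable_chart_frame : measurable_fun setT g.
Proof.
apply/measurable_fun_tnthP => i; rewrite (_ : _ \o _ = (fun t : Rtuple R d =>
    p (chart_index i) + \sum_j (tnth t j : R) * b j (chart_index i))); last first.
  by apply/funext => t; exact: gE.
apply: measurable_funD; first exact: measurable_cst.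
apply: (@measurable_sum _ _ _ _ _ _ (fun j (t : Rtuple R d) =>
  (tnth t j : R) * b j (chart_index i))) => j.
by apply: measurable_funM; [exact: measurable_tnth|exact: measurable_cst].
Qed.

Let g_add t u i : tnth (g (tuple_add t u)) i =
  (tnth (g t) i : R) + ((tnth (g u) i : R) - p (chart_index i)).
Proof.
rewrite !gE -addrA; congr (_ + _).
rewrite addrAC subrr add0r -big_split /=.
by apply: eq_bigr => j _; rewrite tnth_tuple_add mulrDl.
Qed.

Let p_int : L p.
Proof.
have := int_f 0; rewrite (_ : f (int_tuple R 0) = p)//.
rewrite /frame_map big1 ?addr0// => i _.
by rewrite tnth_mktuple ffunE scale0r.
Qed.

(** The passage from the coordinates of one frame to those of another is an affine
bijection that maps integer points to integer points in both directions. *)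
Lemma tuple_measure_chart_frame A : measurable A ->
  tuple_measure (g @^-1` A) = tuple_measure A.
Proof.
pose phi (k : {ffun 'I_d -> int}) : {ffun 'I_n.*2 -> int} :=
  [ffun i => Num.floor ((tnth (g (int_tuple R k)) i : R) - p (chart_index i))].
have phiE k i : ((phi k i)%:~R : R) = (tnth (g (int_tuple R k)) i : R) - p (chart_index i).
  rewrite ffunE floorK// tnth_chart.
  by apply: rpredB; [exact: (int_f k (chart_index i))|exact: (p_int (chart_index i))].
have g_int t k : g (tuple_add t (int_tuple R k)) = tuple_add (g t) (int_tuple R (phi k)).
  apply: eq_from_tnth => i.
  by rewrite g_add tnth_tuple_add [tnth (int_tuple R _) i]tnth_mktuple phiE.
have phi_inj : injective phi.
  move=> k l kl; have : int_tuple R k = int_tuple R l.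
    apply: g_inj; apply: eq_from_tnth => i.
    by have := congr1 (fun h : {ffun 'I_n.*2 -> int} => ((h i)%:~R : R)) kl;
      rewrite !phiE => /addIr.
  move=> /(congr1 (fun t : Rtuple R d => tnth t)) e.
  apply/ffunP => j; have := congr1 (fun h => h j) e.
  by rewrite !tnth_mktuple => /intr_inj.
have phi_surj l : exists k, phi k = l.
  pose s : Rtuple R n.*2 := [tuple (p (chart_index i) + (l i)%:~R : R) | i < n.*2].
  have [||k kE] := @f_int (std s).
  - have [_ _ /seteqP[_ h2]] := chart_lattice_frame R n0.
    have [] // := h2 (std s); exists s => // i.
    by rewrite tnth_mktuple; apply: rpredD; [exact: (p_int (chart_index i))|exact: intr_int].
  - exact: coord_sum_chart_frame.
  exists k; apply/ffunP => i; apply: (@intr_inj R); rewrite phiE.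
  by rewrite /g kE chart_frame_mapK tnth_mktuple addrC addKr.
have [psi psiK] := choice phi_surj.
apply: (tuple_measure_lattice_iso frame_dim measurable_chart_frame (f := phi)) => //.
- by exists psi => // k; apply: phi_inj; rewrite psiK.
- move=> s.
  have [u uE] := g_surj [tuple (p (chart_index i) + (tnth s i : R) : R) | i < n.*2].
  exists u => t; apply: eq_from_tnth => i.
  rewrite g_add uE tnth_tuple_add; congr (_ + _).
  by rewrite tnth_mktuple addrC addKr.
Qed.

End FrameInvariance.

(** * The corner simplex and the normalized volume *)

Section Corner.
Variable R : realType.
Local Notation leb := (@lebesgue_measure R).

Definition corner (d : nat) : set (Rtuple R d) :=
  [set t | all (fun z : R => 0 <= z) t && (\sum_(z <- t) (z : R) <= 1)].

Lemma corner_split d (t : Rtuple R d) :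
  corner t <-> (forall i, 0 <= (tnth t i : R)) /\ \sum_i (tnth t i : R) <= 1.
Proof.
rewrite /corner /= big_tuple; split=> [/andP[/all_tnthP //]|[t0 t1]].
by apply/andP; split => //; apply/all_tnthP.
Qed.

Lemma frame_map_sum (V : lmodType R) d (p : V) (b : 'I_d -> V)
    (I : finType) (a : I -> R) (s : I -> Rtuple R d) : \sum_i a i = 1 ->
  \sum_i a i *: frame_map p b (s i) =
  frame_map p b [tuple (\sum_i a i * (tnth (s i) j : R) : R) | j < d].
Proof.
move=> a1; rewrite /frame_map.
under eq_bigr do rewrite scalerDr.
rewrite big_split /= -scaler_suml a1 scale1r; congr (_ + _).
under eq_bigr do rewrite scaler_sumr.
rewrite exchange_big; apply: eq_bigr => j _.
by rewrite tnth_mktuple scaler_suml; apply: eq_bigr => i _; rewrite scalerA.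
Qed.

(** A frame sends the vertices of the corner simplex to those of its simplex, and
affine maps commute with convex combinations. *)
Lemma preimage_frame_simplex (V : lmodType R) d (p : V) (b : 'I_d -> V) :
  injective (frame_map p b) ->
  frame_map p b @^-1` (frame_simplex p b) = @corner d.
Proof.
move=> finj; apply/seteqP; split => t /=.
  move=> [m [a [v [a0 a1 Sv tE]]]].
  have /choice[s sP] : forall k, exists s, corner s /\ frame_map p b s = v k.
    move=> k; case: (Sv k) => [->|[j _ <-]].
      exists [tuple (0 : R) | i < d]; split.
        by apply/corner_split; split=> [i|]; rewrite ?big1// => *; rewrite tnth_mktuple.
      by rewrite /frame_map big1 ?addr0// => i _; rewrite tnth_mktuple scale0r.
    exists [tuple ((i == j)%:R : R) | i < d]; split.
      apply/corner_split; split=> [i|]; first by rewrite tnth_mktuple.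
      rewrite (bigD1 j)//= tnth_mktuple eqxx big1 ?addr0// => i ij.
      by rewrite tnth_mktuple (negbTE ij).
    rewrite /frame_map (bigD1 j)//= tnth_mktuple eqxx scale1r big1 ?addr0// => i ij.
    by rewrite tnth_mktuple (negbTE ij) scale0r.
  move: tE; under eq_bigr do rewrite -(sP _).2.
  rewrite frame_map_sum// => /finj ->.
  have sC k := (corner_split (s k)).1 (sP k).1.
  apply/corner_split; split=> [j|].
    by rewrite tnth_mktuple sumr_ge0// => k _; rewrite mulr_ge0//; have [] := sC k.
  under eq_bigr do rewrite tnth_mktuple.
  rewrite exchange_big /= -[leRHS]a1; apply: ler_sum => k _.
  by rewrite -mulr_sumr ler_piMr//; have [] := sC k.
move=> /corner_split[t0 t1].
pose a (o : option 'I_d) : R := if o is Some i then tnth t i else 1 - \sum_i (tnth t i : R).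
pose v (o : option 'I_d) : V := if o is Some i then p + b i else p.
have bigo (M : nmodType) (F : option 'I_d -> M) : \sum_o F o = F None + \sum_i F (Some i).
  rewrite (bigD1 None)//= (reindex_omap Some id) => [|[i|]]//=.
  by congr (_ + _); apply: eq_bigl => i; rewrite eqxx.
have -> : frame_map p b t = \sum_o a o *: v o.
  rewrite bigo /= /frame_map.
  have -> : \sum_i (tnth t i : R) *: (p + b i) =
      (\sum_i (tnth t i : R)) *: p + \sum_i (tnth t i : R) *: b i.
    by rewrite scaler_suml -big_split; apply: eq_bigr => i _; rewrite scalerDr.
  by rewrite addrA -scalerDl subrK scale1r.
apply: conv_hull_fin.
- by case=> [i|] /=; rewrite ?subr_ge0.
- by rewrite bigo /= subrK.
- by case=> [i|] /=; [right; exists i|left].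
Qed.

Lemma measurable_bool_set (dT : measure_display) (T : measurableType dT) (P : T -> bool) :
  measurable_fun setT P -> measurable [set t | P t].
Proof.
move=> mP; have := mP measurableT [set true] I; rewrite setTI.
by rewrite (_ : _ @^-1` _ = [set t | P t]).
Qed.

Lemma measurable_corner d : measurable (@corner d).
Proof.
apply: measurable_bool_set; apply: measurable_and; first exact: measurable_tuple_ge0.
by apply: measurable_fun_ler; [exact: measurable_tuple_sum|exact: measurable_cst].
Qed.

Lemma corner_measure_fin d : (tuple_measure (@corner d) < +oo)%E.
Proof.
apply: (@le_lt_trans _ _ (tuple_measure (@cube R d `[0, 1]%classic))).
  apply: le_measure; rewrite ?inE; [exact: measurable_corner|exact: measurable_cube|].
  move=> t /corner_split[t0 t1] i /=; rewrite in_itv/= t0/=.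
  by apply: le_trans t1; rewrite (bigD1 i)//= lerDl sumr_ge0.
rewrite tuple_measure_cube// big1 ?ltry// => i _.
by rewrite lebesgue_measure_itv /= lte01 oppr0 adde0.
Qed.

Lemma corner_measure_gt0 d : (0 < tuple_measure (@corner d))%E.
Proof.
(* any positive number [e] with [d * e <= 1] would do, also for [d = 0] *)
pose e : R := d.+1%:R^-1.
have e0 : 0 < e by rewrite invr_gt0.
apply: (@lt_le_trans _ _ (tuple_measure (@cube R d `[0, e]%classic))).
  rewrite tuple_measure_cube// lebesgue_measure_itv /= lte_fin e0 oppr0 adde0.
  by elim/big_ind : _ => // x y x0 y0; exact: mule_gt0.
apply: le_measure; rewrite ?inE; [exact: measurable_cube|exact: measurable_corner|].
move=> t te; apply/corner_split; split=> [i|].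
  by have := te i; rewrite /= in_itv/= => /andP[].
apply: (@le_trans _ _ (\sum_(i < d) e)).
  by apply: ler_sum => i _; have := te i; rewrite /= in_itv/= => /andP[].
by rewrite sumr_const card_ord -mulr_natl ler_pdivrMr// mul1r ler_nat.
Qed.

Lemma chart_regionE n : @chart_region R n =
  [set t | admissible (path_x t) (path_y t) n && (excess (path_x t) (path_y t) n <= 1)].
Proof. by apply/seteqP; split => t /= /andP. Qed.

Lemma measurable_chart_region n : measurable (@chart_region R n).
Proof.
rewrite chart_regionE; apply: measurable_bool_set; apply: measurable_and.
  exact: measurable_admissible.
by apply: measurable_fun_ler; [exact: measurable_excess|exact: measurable_cst].
Qed.

Lemma chart_region_measure n :
  (tuple_measure (@chart_region R n) = (4 ^ n)%:R%:E * tuple_measure (@corner n.*2))%E.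
Proof.
pose phi (s : R) : \bar R := if s <= 1 then 1%E else 0%E.
have mphi : measurable_fun setT phi.
  apply: measurable_fun_ifT => //.
  by apply: measurable_fun_ler => //; exact: measurable_cst.
have phi0 s : (0 <= phi s)%E by rewrite /phi; case: ifP.
have indE (P Q : Rtuple R n.*2 -> bool) : measurable [set t | P t && Q t] ->
    (tuple_measure [set t | P t && Q t] =
    \int[@tuple_measure R n.*2]_t (if P t then if Q t then 1 else 0 else 0))%E.
  move=> mPQ; rewrite -[X in tuple_measure X]setIT -integral_indic//; apply: eq_integral => t _.
  rewrite indicE (_ : (t \in _) = P t && Q t); first by case: (P t); case: (Q t).
  by apply/idP/idP => [/set_mem//|PQt]; exact/mem_set.
have := @measurable_chart_region n; rewrite chart_regionE => mreg.
rewrite indE// (integral_path_region n mphi phi0) /corner indE//.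
exact: measurable_corner.
Qed.

End Corner.

Theorem corollary3p4 (R : realType) (n : nat) (hn : (0 < n)%N) :
  normalized_volume (@integer_lattice R (path_graph n))
    (@cosmological_polytope R (path_graph n)) = ((4 ^ n)%:R : R)%:E.
Proof.
have volP d p (b : 'I_d -> cspace R (path_graph n)) :
    lattice_frame (@integer_lattice R (path_graph n))
      (@cosmological_polytope R (path_graph n)) p b ->
    (tuple_measure (frame_map p b @^-1` @cosmological_polytope R (path_graph n)) =
     (4 ^ n)%:R%:E * tuple_measure (@corner R d))%E.
  move=> fr.
  have -> : frame_map p b @^-1` @cosmological_polytope R (path_graph n) =
      (fun t => chart (frame_map p b t)) @^-1` @chart_region R n.
    have sum1 t : coord_sum (frame_map p b t) = 1.
      have [_ /seteqP[_ h] _] := fr.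
      by have := h (frame_map p b t); rewrite path_polytope_aff_hull//; apply; exists t.
    apply/seteqP; split => t /=; first by move/(path_polytope_chart hn (sum1 t)).
    by move=> Ct; apply/(path_polytope_chart hn (sum1 t)).
  rewrite (tuple_measure_chart_frame hn fr); last exact: measurable_chart_region.
  by rewrite chart_region_measure (frame_dim hn fr).
have volS d p (b : 'I_d -> cspace R (path_graph n)) :
    lattice_frame (@integer_lattice R (path_graph n))
      (@cosmological_polytope R (path_graph n)) p b ->
    tuple_measure (frame_map p b @^-1` frame_simplex p b) = tuple_measure (@corner R d).
  by move=> [finj _ _]; rewrite preimage_frame_simplex.
rewrite /normalized_volume; case: xgetP => [v _ [d [p [b [c [fr c1 ->]]]]]|none].
  change ((c%:E * tuple_measure
    (frame_map p b @^-1` @cosmological_polytope R (path_graph n)))%E = (4 ^ n)%:R%:E).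
  move: c1.
  change ((c%:E * tuple_measure (frame_map p b @^-1` frame_simplex p b))%E = 1%E ->
   (c%:E * tuple_measure
    (frame_map p b @^-1` @cosmological_polytope R (path_graph n)))%E = (4 ^ n)%:R%:E).
  by rewrite volP// volS// muleCA => ->; rewrite mule1.
have fr := chart_lattice_frame R hn.
(* The standard frame, with the inverse of the measure of the corner simplex as
   the constant, shows that the set of normalized values is not empty. *)
exfalso; pose v := tuple_measure (@corner R n.*2).
have vfin : v \is a fin_num.
  by rewrite ge0_fin_numE ?measure_ge0//; exact: corner_measure_fin.
have v0 : fine v != 0.
  by rewrite gt_eqF// fine_gt0//; apply/andP; split;
    [exact: corner_measure_gt0|exact: corner_measure_fin].
apply: (none (((fine v)^-1)%:E * tuple_measure (frame_map (chart_base R n) (@chart_vec R n)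
   @^-1` @cosmological_polytope R (path_graph n)))%E).
exists n.*2, (chart_base R n), (@chart_vec R n), (fine v)^-1; split => //.
change (((fine v)^-1)%:E * tuple_measure (frame_map (chart_base R n) (@chart_vec R n)
   @^-1` frame_simplex (chart_base R n) (@chart_vec R n)) = 1)%E.
by rewrite volS// -/v -[v in LHS]fineK// -EFinM mulVf.
Qed.
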